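(* Let $n\ge 4$ and let $d$ be a degree sequence. The realization graph $\mathcal{G}(d)$ is a complete graph on $n$ vertices if and only if $d=t\circ\alpha\circ t'$, where each of $t,t'$ is either empty (omitted) or a threshold sequence, and $\alpha$ is $\left(n,2,1^{(n)}\right)$ or $\left(n^{(n)},n-1,1\right)$.
   Context: All graphs are finite and simple. A labeled realization of a degree sequence $d=(d_1,\dots,d_m)$ is a graph on the fixed vertex set $\{v_1,\dots,v_m\}$ in which $v_i$ has degree $d_i$. A 2-switch on a graph $H$ with four distinct vertices $u,v,w,x$ such that $uv,wx\in E(H)$ and $ux,vw\notin E(H)$ deletes $uv,wx$ and adds $ux,vw$. The realization graph $\mathcal{G}(d)$ has the labeled realizations of $d$ as vertices, two being adjacent when one is obtained from the other by a single 2-switch. The notation $t^{(k)}$ in a sequence means the term $t$ repeated $k$ times. A threshold sequence is a degree sequence having exactly one labeled realization. A split graph is a graph whose vertex set can be partitioned into a clique and an independent set. A splitted degree sequence $(p_2;p_1)$ is the degree sequence of a split graph with a specified such partition, where $p_2$ lists (nonincreasingly) the degrees of the clique vertices and $p_1$ those of the independent-set vertices. For a splitted sequence $p=(p_2;p_1)$ and a degree sequence $q$, the composition $p\circ q$ is the sequence obtained by concatenating: the terms of $p_2$ each increased by $|q|$ (the length of $q$), the terms of $q$ each increased by $|p_2|$, and the terms of $p_1$. (Equivalently, it is the degree sequence of the disjoint union of a realization of $p$ and a realization of $q$ with all edges added between the clique part of the former and all vertices of the latter.) When $q=(q_2;q_1)$ is itself splitted, $p\circ q$ is regarded as the splitted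 sequence whose clique part consists of the increased terms of $p_2$ and $q_2$ and whose independent part consists of the increased terms of $q_1$ and the terms of $p_1$; with this convention $\circ$ is associative. In the expression $t\circ\alpha\circ t'$, $t$ (when present) is a splitted threshold sequence and $\alpha$ (when followed by $t'$) is taken in its splitted form, namely $(n,2;1^{(n)})$ or $(n^{(n)};n-1,1)$ respectively. *)

(* Defs.v *)
From HB Require Import structures.
From mathcomp Require Import all_boot.

Set Implicit Arguments.
Unset Strict Implicit.
Unset Printing Implicit Defensive.

Record sgraph (V : finType) : predArgType := SGraph {
  edges : {set {set V}};
  edgesP : [forall e in edges, #|e| == 2]
}.

HB.instance Definition _ (V : finType) := [isSub for @edges V].
HB.instance Definition _ (V : finType) := [Finite of sgraph V by <:].

Section Graphs.
Variable V : finType.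
Implicit Types (G H : sgraph V) (K : {set V}).

Definition adj G : rel V := fun u v => [set u; v] \in edges G.

Definition deg G (v : V) : nat := #|[set w | adj G v w]|.

Definition clique G K : Prop := {in K &, forall u v, u != v -> adj G u v}.

Definition independent G K : Prop := {in K &, forall u v, ~~ adj G u v}.

Definition complete_graph G (n : nat) : Prop :=
  #|V| = n /\ forall u v : V, u != v -> adj G u v.

Definition switch_at G H (u v w x : V) : bool :=
  [&& uniq [:: u; v; w; x],
      adj G u v, adj G w x, ~~ adj G u x, ~~ adj G v w &
      edges H == (edges G :\: [set [set u; v]; [set w; x]])
                   :|: [set [set u; x]; [set v; w]]].

Definition two_switch : rel (sgraph V) := fun G H =>
  [exists u, exists v, exists w, exists x, switch_at G H u v w x].

Lemma two_switch_neq G H : two_switch G H -> G != H.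
Proof.
case/existsP=> u /existsP[v /existsP[w /existsP[x]]].
case/and5P=> _ _ _ ux /andP[_ /eqP eH].
apply: contraNneq ux => GH.
by rewrite /adj GH eH !inE eqxx /= orbT.
Qed.

End Graphs.

Definition realizes (d : seq nat) (G : sgraph 'I_(size d)) : bool :=
  [forall i, deg G i == nth 0 d i].

Record realization (d : seq nat) : predArgType := Realization {
  realization_val : sgraph 'I_(size d);
  realizationP : realizes realization_val
}.

HB.instance Definition _ (d : seq nat) := [isSub for @realization_val d].
HB.instance Definition _ (d : seq nat) := [Finite of realization d by <:].

(* Edges are unordered pairs, so this identifies "G is obtained from H" with
   "H is obtained from G". *)
Definition realization_edges (d : seq nat) : {set {set realization d}} :=
  [set [set GH.1; GH.2] | GH : realization d * realization d
                          & two_switch (val GH.1) (val GH.2)].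

Lemma realization_edgesP (d : seq nat) :
  [forall e in realization_edges d, #|e| == 2].
Proof.
apply/forall_inP=> e /imsetP[[G H]]; rewrite inE /= => /two_switch_neq neq ->.
by rewrite cards2; case: (G =P H) neq => [->|//]; rewrite eqxx.
Qed.

Definition realization_graph (d : seq nat) : sgraph (realization d) :=
  SGraph (realization_edgesP d).

(* The terms may come in any order: vertex i gets the i-th term. Two degree
   sequences are thus to be compared up to permutation (perm_eq). *)
Definition degree_sequence (d : seq nat) : Prop :=
  exists G : sgraph 'I_(size d), realizes G.

Definition threshold_sequence (d : seq nat) : Prop :=
  degree_sequence d /\ #|{: realization d}| = 1.

(* A pair (p_2, p_1) stands for (p_2; p_1): clique degrees come first. *)
Definition splitted := (seq nat * seq nat)%type.

Definition seq_of_splitted (p : splitted) : seq nat := p.1 ++ p.2.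

Definition splitted_degree_sequence (p : splitted) : Prop :=
  exists (m : nat) (G : sgraph 'I_m) (K : {set 'I_m}),
    [/\ clique G K, independent G (~: K),
        p.1 = sort geq [seq deg G v | v <- enum K]
      & p.2 = sort geq [seq deg G v | v <- enum (~: K)]].

Definition splitted_threshold_sequence (p : splitted) : Prop :=
  splitted_degree_sequence p /\ threshold_sequence (seq_of_splitted p).

Definition empty_splitted : splitted := ([::], [::]).

Definition compose (p : splitted) (q : seq nat) : seq nat :=
  map (addn (size q)) p.1 ++ map (addn (size p.1)) q ++ p.2.

Definition scompose (p q : splitted) : splitted :=
  (map (addn (size (seq_of_splitted q))) p.1 ++ map (addn (size p.1)) q.1,
   map (addn (size p.1)) q.2 ++ p.2).

(* Composing with an empty sequence amounts to omitting the factor. *)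
Lemma scompose_empty (p : splitted) : scompose empty_splitted p = p.
Proof.
case: p => a b; rewrite /scompose /= cats0.
by congr (_, _); apply: map_id_in.
Qed.

Lemma compose_nil (p : splitted) : compose p [::] = seq_of_splitted p.
Proof. by rewrite /compose /=; congr (_ ++ _); apply: map_id_in. Qed.

Lemma seq_of_scompose (p q : splitted) :
  seq_of_splitted (scompose p q) = compose p (seq_of_splitted q).
Proof. by rewrite /compose /seq_of_splitted /= map_cat !catA. Qed.

Lemma composeA (p q : splitted) (r : seq nat) :
  compose (scompose p q) r = compose p (compose q r).
Proof.
case: p q => [a b] [a' b']; rewrite /compose /scompose /seq_of_splitted /=.
rewrite !map_cat -!catA !size_cat !size_map -!map_comp.
congr (_ ++ (_ ++ (_ ++ _))); apply: eq_map => k /=; rewrite !addnA //.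
- by rewrite [size r + _]addnC addnAC.
- by rewrite [size r + _]addnC.
Qed.

Definition alpha_star (n : nat) : splitted := ([:: n; 2], nseq n 1).
Definition alpha_costar (n : nat) : splitted := (nseq n n, [:: n.-1; 1]).

(* Main.v *)
Require Import Defs.
From mathcomp Require Import all_boot zify.

(** Two realizations at distance one differ in exactly four pairs, so in a
complete realization graph any two alternating 4-cycles of a realization G
share exactly two pairs. With at least three such cycles they must all have
the form (a, x, c, y) with a, x, c fixed: the vertices x and y lie in a set of
"leaves" on which a has one neighbour and c one non-neighbour. Every other
4-tuple failing to alternate forces the leaves to be independent (when a and c
are adjacent) or a clique (when they are not), every further vertex to be
homogeneous towards this configuration, and hence G to be a composition
t o alpha o t'; the outer parts are threshold since replacing one of them by
another realization would be a 2-switch that does not move the edge ax.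
Conversely, an equality between degree sums forces this layered shape on every
realization, so a realization is determined by the unique leaf adjacent to a,
and moving that leaf is a single 2-switch. *)

Set Implicit Arguments.
Unset Strict Implicit.
Unset Printing Implicit Defensive.

(** Sharing exactly two pairs still allows two cycles to share both edges, or both nonedges, as the
    two cycles through a given pair of disjoint edges do. A third cycle cannot coexist with two such
    cycles; this is the use of [n >= 4], which puts three realizations next to [G], and any two
    cycles then share one edge and one nonedge. The statements on edges and on nonedges are
    complementary, so the combinatorics is done for an abstract family of 4-tuples that can be
    reread with the two kinds exchanged. In the converse, an arbitrary realization is known by its
    degrees alone, with no partition given. What survives is an identity between the clique and the
    independent degree sums of each split factor. Together with the shifts made by the composition
    it makes an Erdos-Gallai type inequality tight twice: for label 0 against 4, and for labels 0, 1
    against 3, 4. Tightness decides every pair whose label sum is not 4. *)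

Section Pairs.
Variable V : finType.
Implicit Types (u v w x : V).

Lemma set2_eq u v w x :
  ([set u; v] == [set w; x]) = (u == w) && (v == x) || (u == x) && (v == w).
Proof.
apply/eqP/idP => [e|].
  have : u \in [set w; x] by rewrite -e set21.
  have : v \in [set w; x] by rewrite -e set22.
  have : w \in [set u; v] by rewrite e set21.
  have : x \in [set u; v] by rewrite e set22.
  rewrite !inE ![w == _]eq_sym ![x == _]eq_sym.
  by do ![case: eqVneq => //= ?]; subst; rewrite ?eqxx.
by case/orP=> /andP[/eqP-> /eqP->] //; rewrite setUC.
Qed.

End Pairs.

(** * Alternating 4-cycles and 2-switches *)

Section Graphs.
Variable V : finType.
Implicit Types (G H : sgraph V) (u v w x : V) (r : rel V).

Lemma adjC G u v : adj G u v = adj G v u.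
Proof. by rewrite /adj setUC. Qed.

Lemma adjnn G u : adj G u u = false.
Proof.
apply/negP => uu; have /forall_inP/(_ _ uu) := edgesP G.
by rewrite setUid cards1.
Qed.

Lemma adj_neq G u v : adj G u v -> u != v.
Proof. by apply: contraTneq => ->; rewrite adjnn. Qed.

Lemma sgraph_ext G H : adj G =2 adj H -> G = H.
Proof.
move=> e; apply/val_inj/setP => p /=.
suff [[u [v ->]]|[nG nH]] :
    (exists u v, p = [set u; v]) \/ p \notin edges G /\ p \notin edges H.
- exact: e.
- by rewrite (negPf nG) (negPf nH).
have [/cards2P[u [v [_ ->]]]|n2] := boolP (#|p| == 2).
  by left; exists u, v.
right; split; apply: contraNN n2 => pG.
- by have /forall_inP/(_ _ pG) := edgesP G.
- by have /forall_inP/(_ _ pG) := edgesP H.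
Qed.

Definition rel_edges r : {set {set V}} :=
  [set [set p.1; p.2] | p : V * V & (p.1 != p.2) && r p.1 p.2].

Lemma rel_edgesP r : [forall e in rel_edges r, #|e| == 2].
Proof.
apply/forall_inP => e /imsetP[[u v]]; rewrite inE /= => /andP[uv _] ->.
by rewrite cards2 uv.
Qed.

Definition rel_graph r : sgraph V := SGraph (rel_edgesP r).

Lemma adj_rel_graph r u v :
  symmetric r -> adj (rel_graph r) u v = (u != v) && r u v.
Proof.
move=> rC; apply/imsetP/idP => [[[p q]]|uv]; last by exists (u, v); rewrite ?inE.
rewrite inE /= => /andP[pq rpq] /eqP; rewrite set2_eq.
by case/orP => /andP[/eqP-> /eqP->]; rewrite ?pq // eq_sym pq rC.
Qed.

Definition alternating G u v w x : bool :=
  [&& uniq [:: u; v; w; x], adj G u v, adj G w x, ~~ adj G u x & ~~ adj G v w].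

(** A 2-switch complements adjacency on the four pairs of its cycle. Written with [(+)], successive
    switches are compared by addition modulo 2. *)
Definition toggled u v w x : rel V := fun p q =>
  [|| [set p; q] == [set u; v], [set p; q] == [set w; x],
      [set p; q] == [set u; x] | [set p; q] == [set v; w]].

Lemma toggledC u v w x : symmetric (toggled u v w x).
Proof. by move=> p q; rewrite /toggled setUC. Qed.

Definition switched G u v w x : sgraph V :=
  rel_graph (fun p q => adj G p q (+) toggled u v w x p q).

Lemma toggled_adj G u v w x p q : alternating G u v w x ->
  toggled u v w x p q =
  if adj G p q then ([set p; q] == [set u; v]) || ([set p; q] == [set w; x])
  else ([set p; q] == [set u; x]) || ([set p; q] == [set v; w]).
Proof.
rewrite /alternating /toggled /adj => /and5P[_ uv wx ux vw].
case: (eqVneq [set p; q] [set u; v]) => [->|_]; first by rewrite uv.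
case: (eqVneq [set p; q] [set w; x]) => [->|_]; first by rewrite wx.
case: (eqVneq [set p; q] [set u; x]) => [->|_]; first by rewrite (negPf ux).
case: (eqVneq [set p; q] [set v; w]) => [->|_]; first by rewrite (negPf vw).
by case: ifP.
Qed.

Lemma two_switchP G H :
  reflect (exists u v w x, alternating G u v w x /\
             forall p q, adj H p q = adj G p q (+) toggled u v w x p q)
          (two_switch G H).
Proof.
have E u v w x p q : alternating G u v w x ->
    ([set p; q] \in edges G :\: [set [set u; v]; [set w; x]]
                   :|: [set [set u; x]; [set v; w]])
    = adj G p q (+) toggled u v w x p q.
  case/and5P=> _ uv wx ux vw; rewrite /toggled !inE.
  have : ([set p; q] == [set u; v]) ==> adj G p q by apply/implyP;
    rewrite /adj => /eqP ->.
  have : ([set p; q] == [set w; x]) ==> adj G p q by apply/implyP;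
    rewrite /adj => /eqP ->.
  have : ([set p; q] == [set u; x]) ==> ~~ adj G p q by apply/implyP;
    rewrite /adj => /eqP ->.
  have : ([set p; q] == [set v; w]) ==> ~~ adj G p q by apply/implyP;
    rewrite /adj => /eqP ->.
  rewrite /adj; case: ([set p; q] \in edges G);
  case: (_ == [set u; v]); case: (_ == [set w; x]); case: (_ == [set u; x]);
  by case: (_ == [set v; w]).
apply: (iffP existsP).
  case=> u /existsP[v /existsP[w /existsP[x]]].
  case/and5P=> ? ? ? ? /andP[? /eqP eH]; exists u, v, w, x.
  have alt : alternating G u v w x by apply/and5P.
  by split=> // p q; rewrite -(E _ _ _ _ p q alt) /adj eH.
case=> u [v [w [x [alt eH]]]]; exists u; apply/existsP; exists v.
apply/existsP; exists w; apply/existsP; exists x.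
case/and5P: (alt) => ? ? ? ? ?; apply/and5P; split=> //; apply/andP; split=> //.
have [uv wx] : u != x /\ v != w.
  by split; apply: contraTneq (alt) => ->; rewrite /alternating /= !inE eqxx ?orbT
    ?andbF.
pose e := edges G :\: [set [set u; v]; [set w; x]] :|: [set [set u; x]; [set v; w]].
have P : [forall s in e, #|s| == 2].
  apply/forall_inP => s; rewrite !inE => /orP[/andP[_ sG]|].
    by have /forall_inP/(_ _ sG) := edgesP G.
  by case/orP => /eqP ->; rewrite cards2 ?uv ?wx.
suff -> : H = SGraph P by [].
by apply: sgraph_ext => p q; rewrite eH -(E _ _ _ _ p q alt).
Qed.

Lemma alternatingC G u v w x : alternating G u v w x -> alternating G v u x w.
Proof.
rewrite /alternating /= !inE !negb_or [adj G v u]adjC [adj G x w]adjC.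
case/and5P=> /and3P[/and3P[uv uw ux] /andP[vw vx] /andP[wx _]] -> -> -> ->.
by rewrite vx vw ux uw ![v == u]eq_sym ![x == w]eq_sym uv wx.
Qed.

Lemma alternating_rot G u v w x : alternating G u v w x -> alternating G w x u v.
Proof.
rewrite /alternating /= !inE !negb_or [adj G w v]adjC [adj G x u]adjC.
case/and5P=> /and3P[/and3P[uv uw ux] /andP[vw vx] /andP[wx _]] -> -> -> ->.
by rewrite wx uv ![w == _]eq_sym ![x == _]eq_sym uw vw ux vx.
Qed.

Lemma alternatingI G u v w x : u != w -> v != x ->
  adj G u v -> adj G w x -> ~~ adj G u x -> ~~ adj G v w ->
  u != x -> v != w -> alternating G u v w x.
Proof.
move=> uw vx uv wx nux nvw ux vw; apply/and5P; split=> //=.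
by rewrite !inE !negb_or (adj_neq uv) (adj_neq wx) uw ux vw vx.
Qed.

Lemma adj_switched G u v w x p q : alternating G u v w x ->
  adj (switched G u v w x) p q = adj G p q (+) toggled u v w x p q.
Proof.
move=> alt; rewrite adj_rel_graph => [|s t]; last by rewrite adjC toggledC.
(* [rel_graph] discards loops, so the diagonal needs that no pair of the cycle is a singleton. *)
case: eqVneq => //= ->; rewrite adjnn (toggled_adj _ _ alt) adjnn setUid.
case/and5P: alt; rewrite /= !inE !negb_or.
case/and3P=> /and3P[_ _ ux] /andP[vw _] _ _ _ _ _.
by apply/esym/negbTE/norP; split; apply/eqP => /(congr1 (fun s : {set V} => #|s|));
  rewrite cards1 cards2 ?ux ?vw.
Qed.

Lemma two_switch_switched G u v w x :
  alternating G u v w x -> two_switch G (switched G u v w x).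
Proof.
by move=> alt; apply/two_switchP; exists u, v, w, x; split=> // p q;
  apply: adj_switched.
Qed.

Lemma deg_sum G v : deg G v = \sum_w adj G v w.
Proof.
rewrite /deg -sum1dep_card big_mkcond.
by apply: eq_bigr => w _; case: adj.
Qed.

Lemma two_switch_sym G H : two_switch G H -> two_switch H G.
Proof.
case/two_switchP=> u [v [w [x [alt eH]]]]; apply/two_switchP.
(* The inverse switch runs along the same cycle backwards: its edges are the pairs just added. *)
exists u, x, w, v; split=> [|p q]; last first.
  by rewrite eH -addbA /toggled ![[set w; v]]setUC ![[set x; w]]setUC;
    case: (adj G p q); case: (_ == [set u; v]); case: (_ == [set w; x]);
      case: (_ == [set u; x]); case: (_ == [set v; w]).
case/and5P: (alt); rewrite /= !inE !negb_or.
case/and3P=> /and3P[uv uw ux] /andP[vw vx] /andP[wx _] Guv Gwx Gux Gvw.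
by apply: alternatingI => //; rewrite ?eH ?(eq_sym x) // ?[adj G w v]adjC ?[adj G x
  w]adjC
  ?(negPf Gux) ?(negPf Gvw) ?Guv ?Gwx /toggled 1?[[set w; v]]setUC 1?[[set x;
    w]]setUC eqxx ?orbT.
Qed.

Lemma sum_pair_eq (z u v : V) : u != v ->
  \sum_q ([set z; q] == [set u; v] : nat) = (z == u) + (z == v).
Proof.
move=> uv; rewrite (bigD1 (if z == u then v else u)) //= big1 ?addn0.
  by rewrite set2_eq; case: (eqVneq z u) => [->|zu];
    rewrite ?eqxx ?(negPf uv) //= andbT.
move=> q; rewrite set2_eq.
by case: (z =P u) => [->|_] /negPf nq; rewrite nq ?(negPf uv) ?andbF.
Qed.

(** Each vertex of the cycle lies on one deleted and one added pair. Deleted pairs are added back on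
    the side of [H] and added pairs on the side of [G], which avoids subtraction. *)
Lemma deg_switch G H : two_switch G H -> deg H =1 deg G.
Proof.
case/two_switchP=> u [v [w [x [alt eH]]]] z.
case/and5P: (alt); rewrite /= !inE !negb_or.
case/and3P=> /and3P[uv uw ux] /andP[vw vx] /andP[wx _] Guv Gwx Gux Gvw.
have E : \sum_q (([set z; q] == [set u; v]) + ([set z; q] == [set w; x])) =
  \sum_q (([set z; q] == [set u; x]) + ([set z; q] == [set v; w])).
  by rewrite !big_split /= !sum_pair_eq // [(z == w) + _]addnC addnACA.
suff : deg H z + \sum_q (([set z; q] == [set u; v]) + ([set z; q] == [set w; x]))
  = deg G z + \sum_q (([set z; q] == [set u; x]) + ([set z; q] == [set v; w])).
  by rewrite E => /addIn.
rewrite !deg_sum -!big_split; apply: eq_bigr => q _ /=;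
  rewrite eH /toggled /adj !set2_eq.
move: Guv Gwx Gux Gvw; rewrite /adj.
case: (eqVneq z u) => [?|_] /=; [subst z|].
  rewrite (negPf uv) (negPf uw) (negPf ux) /=.
  case: (eqVneq q v) => [?|_] /=; [subst q|]; first by rewrite (negPf vx) => ->.
  by case: (eqVneq q x) => [->|_] /=; rewrite ?addbF ?addn0 // => _ _ /negPf->.
case: (eqVneq z v) => [?|_] /=; [subst z|].
  rewrite (negPf vw) (negPf vx) /= ?orbF.
  case: (eqVneq q u) => [->|_] /=; first by rewrite (negPf uw) setUC => ->.
  by case: (eqVneq q w) => [->|_] /=; rewrite ?addbF ?addn0 // => _ _ _ /negPf->.
case: (eqVneq z w) => [?|_] /=; [subst z|].
  rewrite (negPf wx) /= ?orbF.
  case: (eqVneq q x) => [->|_] /=; first by rewrite eq_sym (negPf vx) => _ ->.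
  by case: (eqVneq q v) => [->|_] /=; rewrite ?addbF ?addn0 // [[set w;
    v]]setUC => _ _ _ /negPf->.
case: (eqVneq z x) => [?|_] /=; [subst z|]; last by rewrite addbF.
case: (eqVneq q w) => [->|_] /=; first by rewrite (eq_sym w) (negPf uw) [[set x;
  w]]setUC => _ ->.
by case: (eqVneq q u) => [->|_] /=; rewrite ?addbF ?addn0 // [[set x;
  u]]setUC => _ _ /negPf->.
Qed.

Lemma deg_switched G u v w x : alternating G u v w x ->
  deg (switched G u v w x) =1 deg G.
Proof. by move=> alt; apply/deg_switch/two_switch_switched. Qed.

End Graphs.

(** * The pairs of a 4-cycle *)

Section CyclePairs.
Variable V : finType.
Implicit Types (u v w x : V) (e f : {set V}).

Lemma set2_eqP u v w x :
  [set u; v] = [set w; x] -> u = w /\ v = x \/ u = x /\ v = w.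
Proof. by move/eqP; rewrite set2_eq => /orP[]/andP[/eqP-> /eqP->];
  [left|right]. Qed.

Lemma uniq4P u v w x : uniq [:: u; v; w; x] ->
  [/\ u <> v, u <> w & u <> x] /\ [/\ v <> w, v <> x & w <> x].
Proof.
rewrite /= !inE !negb_or.
by case/and3P=> /and3P[/eqP? /eqP? /eqP?] /andP[/eqP? /eqP?] /andP[/eqP? _].
Qed.

Definition cycle_edges u v w x : seq {set V} := [:: [set u; v]; [set w; x]].
Definition cycle_nonedges u v w x : seq {set V} := [:: [set u; x]; [set v; w]].
Definition cycle_pairs u v w x : {set {set V}} :=
  [set e in cycle_edges u v w x ++ cycle_nonedges u v w x].

Lemma cycle_pairsC u v w x : cycle_pairs v u x w = cycle_pairs u v w x.
Proof.
apply/setP => e; rewrite !inE ![[set v; u]]setUC ![[set x; w]]setUC.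
by rewrite [(e == [set v; w]) || _]orbC.
Qed.

Lemma cycle_pairs_rot u v w x : cycle_pairs w x u v = cycle_pairs u v w x.
Proof.
apply/setP => e; rewrite !inE ![[set w; v]]setUC ![[set x; u]]setUC.
by rewrite orbCA [(e == [set v; w]) || _]orbC.
Qed.

(** Unlike the two symmetries above, this shift by one vertex exchanges the edges and the nonedges
    of the cycle; it plays the part of complementation. *)
Lemma cycle_pairs_dual u v w x : cycle_pairs x u v w = cycle_pairs u v w x.
Proof.
apply/setP => e; rewrite !inE ![[set x; u]]setUC ![[set x; w]]setUC.
by do 4!case: (e == _).
Qed.

(** Edges are compared with edges and nonedges with nonedges only: for two cycles of the same graph
    no other coincidence is possible. *)
Definition common_pairs u v w x u' v' w' x' : nat :=
  (count (mem (cycle_edges u v w x)) (cycle_edges u' v' w' x') +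
   count (mem (cycle_nonedges u v w x)) (cycle_nonedges u' v' w' x')).

End CyclePairs.

(** * Families of 4-cycles that pairwise share two pairs *)

Section CycleFamily.
Variable V : finType.
Implicit Types (u v w x p q r s : V).
Variable A : V -> V -> V -> V -> Prop.
Hypothesis A_uniq : forall u v w x, A u v w x -> uniq [:: u; v; w; x].
Hypothesis A_C : forall u v w x, A u v w x -> A v u x w.
Hypothesis A_rot : forall u v w x, A u v w x -> A w x u v.
Hypothesis A_common : forall u v w x u' v' w' x', A u v w x -> A u' v' w' x' ->
  cycle_pairs u v w x <> cycle_pairs u' v' w' x' ->
  common_pairs u v w x u' v' w' x' = 2.

(** An edge and a nonedge of a 4-cycle always have one common vertex [x], and the symmetries of [A]
    cover the four choices. [A] is kept abstract, instead of [alternating G], so that it can later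
    be replaced by its complementary reading. *)
Lemma cycle_normal_form p q r s e f :
  A p q r s -> e \in cycle_edges p q r s -> f \in cycle_nonedges p q r s ->
  exists a x c y, [/\ A a x c y, cycle_pairs p q r s = cycle_pairs a x c y,
                      e = [set a; x] & f = [set x; c]].
Proof.
rewrite !inE => Ap /orP[]/eqP-> /orP[]/eqP->.
- by exists q, p, s, r; split; [exact: A_C|rewrite cycle_pairsC|rewrite setUC|].
- by exists p, q, r, s.
- exists r, s, p, q; split; [exact: A_rot|by rewrite cycle_pairs_rot|by []|].
  by rewrite setUC.
- exists s, r, q, p; split; [exact/A_rot/A_C| |by rewrite setUC|by rewrite setUC].
  by rewrite cycle_pairs_rot cycle_pairsC.
Qed.

Lemma cycle_through p q r s a x c :
  A p q r s -> [set a; x] \in cycle_edges p q r s ->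
  [set x; c] \in cycle_nonedges p q r s ->
  exists2 y, A a x c y & cycle_pairs p q r s = cycle_pairs a x c y.
Proof.
move=> Ap ax xc; have [a' [x' [c' [y [A' -> /eqP]]]]] := cycle_normal_form Ap ax xc.
move=> + /eqP; have /= := A_uniq A'; rewrite !set2_eq !inE !negb_or.
case/and3P=> /and3P[ax' ac' _] /andP[xc' _] _.
case/orP=> /andP[/eqP ? /eqP ?]; subst.
  rewrite eqxx (negPf xc') orbF /= => /eqP->.
  by exists y.
by rewrite (negPf ax') (negPf ac').
Qed.

(** Two disjoint edges can be joined by two disjoint nonedges in only two ways. *)
Lemma cycle_edges_eq p q r s u v w x : A p q r s ->
  [set u; v] \in cycle_edges p q r s -> [set w; x] \in cycle_edges p q r s ->
  uniq [:: u; v; w; x] ->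
  A u v w x /\ cycle_pairs p q r s = cycle_pairs u v w x \/
  A u v x w /\ cycle_pairs p q r s = cycle_pairs u v x w.
Proof.
move=> Ap uv wx U.
wlog uvE : p q r s Ap wx uv / [set u; v] == [set p; q].
  move=> H; case: (boolP ([set u; v] == [set p; q])) => [|n]; first exact: H.
  rewrite -cycle_pairs_rot; apply: H; first exact: A_rot.
  - by move: wx; rewrite !inE orbC.
  - by move: uv; rewrite !inE orbC.
  by move: uv; rewrite !inE (negPf n).
wlog [? ?] : p q r s Ap wx {uv uvE} / u = p /\ v = q.
  move=> H; move: uvE; rewrite set2_eq => /orP[]/andP[/eqP eu /eqP ev].
    exact: H.
  rewrite -cycle_pairsC; apply: H => //; first exact: A_C.
  by move: wx; rewrite !inE ![[set q; p]]setUC ![[set s; r]]setUC.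
subst p q; have [[? ? ?] [? ? ?]] := uniq4P U; move: wx; rewrite !inE.
case/orP=> /eqP/set2_eqP[][? ?]; first [congruence | by subst; auto].
Qed.

Lemma cycle_pairs_cross u v w x : uniq [:: u; v; w; x] ->
  cycle_pairs u v w x <> cycle_pairs u v x w.
Proof.
move=> U /setP/(_ [set u; x]); rewrite !inE eqxx !orbT => /esym.
by have [[? ? ?] [? ? ?]] := uniq4P U; case/or4P=> /eqP/set2_eqP[][? ?]; congruence.
Qed.

(** Any nonedge of the first cycle meets any nonedge of the second. The nonedges of the third are
    disjoint, so it misses those of one of the two; it then shares both edges with that cycle, hence
    is one of the two. *)
Lemma no_three_same_edges u v w x p q r s :
  A u v w x -> A u v x w -> A p q r s ->
  cycle_pairs u v w x <> cycle_pairs p q r s ->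
  cycle_pairs u v x w <> cycle_pairs p q r s -> False.
Proof.
move=> A1 A2 A3 n1 n2.
have := A_common A1 A3 n1; have := A_common A2 A3 n2.
have U1 := A_uniq A1; have U3 := A_uniq A3.
rewrite /common_pairs.
have -> : count (mem (cycle_edges u v x w)) (cycle_edges p q r s) =
          count (mem (cycle_edges u v w x)) (cycle_edges p q r s).
  by apply: eq_count => e; rewrite !inE [[set x; w]]setUC.
have [|N1] := boolP (has (mem (cycle_nonedges u v w x)) (cycle_nonedges p q r s));
have [|N2] := boolP (has (mem (cycle_nonedges u v x w)) (cycle_nonedges p q r s)).
- move=> h2 h1 _ _; have [[? ? ?] [? ? ?]] := uniq4P U1.
  have [[? ? ?] [? ? ?]] := uniq4P U3.
  move: h1 h2; rewrite /= !inE !orbF.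
  by case/orP=> /orP[]/eqP/set2_eqP[][? ?]; case/orP=> /orP[]/eqP/set2_eqP[][? ?];
    congruence.
- by move: N2; rewrite !has_count -eqn0Ngt => /eqP->; clear; lia.
- by move: N1; rewrite !has_count -eqn0Ngt => /eqP->; clear; lia.
move: N1 N2; rewrite !has_count -!eqn0Ngt => /eqP -> /eqP-> _; rewrite addn0 => nE.
have {nE} : all (mem (cycle_edges u v w x)) (cycle_edges p q r s) by rewrite
  all_count nE.
case/and3P=> pq rs _.
have [[_ //]|[_ E1]] := cycle_edges_eq A1 pq rs U3.
have [||[_ //]|[_ E2]] := cycle_edges_eq (u := p) (v := q) (w := r) (x := s) A2 _ _
  U3.
- by move: pq; rewrite !inE ![[set x; w]]setUC.
- by move: rs; rewrite !inE ![[set x; w]]setUC.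
by apply: (cycle_pairs_cross U1); rewrite E1.
Qed.

(** Without a common nonedge both edges are shared, and the two cycles are the two joins of these
    edges: a third cycle forbids this. *)
Lemma common_nonedge u v w x u' v' w' x' p q r s :
  A u v w x -> A u' v' w' x' -> A p q r s ->
  cycle_pairs u v w x <> cycle_pairs u' v' w' x' ->
  cycle_pairs u v w x <> cycle_pairs p q r s ->
  cycle_pairs u' v' w' x' <> cycle_pairs p q r s ->
  has (mem (cycle_nonedges u v w x)) (cycle_nonedges u' v' w' x').
Proof.
move=> A1 A2 A3 n12 n13 n23; apply/negPn/negP; rewrite has_count -eqn0Ngt => /eqP N.
have := A_common A1 A2 n12; rewrite /common_pairs N addn0 => nE.
have {nE} : all (mem (cycle_edges u v w x)) (cycle_edges u' v' w' x').
  by rewrite all_count nE.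
case/and3P=> pq rs _.
have [[_ //]|[A2' E2]] := cycle_edges_eq A1 pq rs (A_uniq A2).
by apply: (no_three_same_edges A2 A2' A3) => //; rewrite -E2.
Qed.

End CycleFamily.

Section HubShape.
Variable V : finType.
Implicit Types (u v w x p q r s : V).
Variable A : V -> V -> V -> V -> Prop.
Hypothesis A_uniq : forall u v w x, A u v w x -> uniq [:: u; v; w; x].
Hypothesis A_C : forall u v w x, A u v w x -> A v u x w.
Hypothesis A_rot : forall u v w x, A u v w x -> A w x u v.
Hypothesis A_common : forall u v w x u' v' w' x', A u v w x -> A u' v' w' x' ->
  cycle_pairs u v w x <> cycle_pairs u' v' w' x' ->
  common_pairs u v w x u' v' w' x' = 2.

(* Passing to the complement exchanges edges and nonedges. *)
Lemma common_edge u v w x u' v' w' x' p q r s :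
  A u v w x -> A u' v' w' x' -> A p q r s ->
  cycle_pairs u v w x <> cycle_pairs u' v' w' x' ->
  cycle_pairs u v w x <> cycle_pairs p q r s ->
  cycle_pairs u' v' w' x' <> cycle_pairs p q r s ->
  has (mem (cycle_edges u v w x)) (cycle_edges u' v' w' x').
Proof.
move=> A1 A2 A3 n12 n13 n23.
(* Reading each cycle from its second vertex on turns its edges into nonedges and conversely. *)
pose B u v w x := A x u v w.
suff : has (mem (cycle_nonedges v w x u)) (cycle_nonedges v' w' x' u').
  by rewrite /= !inE [[set v; u]]setUC [[set v'; u']]setUC.
have uniqB a b c e : B a b c e -> uniq [:: a; b; c; e].
  by move/A_uniq; rewrite -(rot_uniq 1).
have BC a b c e : B a b c e -> B b a e c by move/A_C/A_rot.
have Brot a b c e : B a b c e -> B c e a b by move/A_rot.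
apply: (common_nonedge uniqB BC Brot _ A1 A2 A3).
- move=> a b c e a' b' c' e' B1 B2; rewrite -!(cycle_pairs_dual a)
  -(cycle_pairs_dual a') => n.
  rewrite -(A_common B1 B2 n) /common_pairs /= !inE addnC ![[set e;
    a]]setUC ![[set e'; a']]setUC ![[set e; c]]setUC ![[set e'; c']]setUC.
  lia.
- by rewrite -!(cycle_pairs_dual v) -(cycle_pairs_dual v').
- by rewrite -!(cycle_pairs_dual v) -(cycle_pairs_dual q).
- by rewrite -!(cycle_pairs_dual v') -(cycle_pairs_dual q).
Qed.

(** The first two cycles share an edge [ax] and a nonedge [xc], so they are [a x c y1] and
    [a x c y2]. A further cycle shares an edge with each; if this is not [ax], it contains both
    [c y1] and [c y2], which meet, whereas edges of a cycle are disjoint. The same holds for the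
    nonedge, with [a y1] and [a y2]. *)
Lemma common_hub u1 v1 w1 x1 u2 v2 w2 x2 u3 v3 w3 x3 :
  A u1 v1 w1 x1 -> A u2 v2 w2 x2 -> A u3 v3 w3 x3 ->
  cycle_pairs u1 v1 w1 x1 <> cycle_pairs u2 v2 w2 x2 ->
  cycle_pairs u1 v1 w1 x1 <> cycle_pairs u3 v3 w3 x3 ->
  cycle_pairs u2 v2 w2 x2 <> cycle_pairs u3 v3 w3 x3 ->
  exists a x c, forall p q r s, A p q r s ->
    exists2 y, A a x c y & cycle_pairs p q r s = cycle_pairs a x c y.
Proof.
move=> A1 A2 A3 n12 n13 n23.
have /hasP[e /= e2 e1] := common_edge A1 A2 A3 n12 n13 n23.
have /hasP[f /= f2 f1] := common_nonedge A_uniq A_C A_rot A_common A1 A2 A3 n12 n13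
  n23.
have [a [x [c [y1 [Ay1 E1 ee ff]]]]] := cycle_normal_form A_C A_rot A1 e1 f1; subst.
have [y2 Ay2 E2] := cycle_through A_uniq A_C A_rot A2 e2 f2.
have ny : y1 <> y2 by move=> y; apply: n12; rewrite E1 E2 y.
have n : cycle_pairs a x c y1 <> cycle_pairs a x c y2 by rewrite -E1 -E2.
exists a, x, c => p q r s Ap.
have [->|/eqP m1] := eqVneq (cycle_pairs p q r s) (cycle_pairs a x c y1);
  first by exists y1.
have [->|/eqP m2] := eqVneq (cycle_pairs p q r s) (cycle_pairs a x c y2);
  first by exists y2.
have [[? ? ?] [? ? ?]] := uniq4P (A_uniq Ap).
have [[? ? ?] [? ? ?]] := uniq4P (A_uniq Ay1).
have [[? ? ?] [? ? ?]] := uniq4P (A_uniq Ay2).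
apply: (cycle_through A_uniq A_C A_rot Ap).
- have := common_edge Ap Ay1 Ay2 m1 m2 n.
  have := common_edge Ap Ay2 Ay1 m2 m1 (not_eq_sym n).
  rewrite /= !orbF => /orP[//|+] /orP[//|]; rewrite !inE => /orP[]/eqP/set2_eqP[][?
    ?] /orP[]/eqP/set2_eqP[][? ?]; congruence.
- have := common_nonedge A_uniq A_C A_rot A_common Ap Ay1 Ay2 m1 m2 n.
  have := common_nonedge A_uniq A_C A_rot A_common Ap Ay2 Ay1 m2 m1 (not_eq_sym n).
  rewrite /= !orbF => /orP[+|//] /orP[|//]; rewrite !inE => /orP[]/eqP/set2_eqP[][?
    ?] /orP[]/eqP/set2_eqP[][? ?]; congruence.
Qed.

End HubShape.

(** * Alternating cycles when all realizations are adjacent *)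

Section AlternatingFamily.
Variables (V : finType) (G : sgraph V).
Hypothesis all_switch : forall H1 H2 : sgraph V,
  deg H1 =1 deg G -> deg H2 =1 deg G -> H1 != H2 -> two_switch H1 H2.

Lemma toggledE (u v w x p q : V) :
  toggled u v w x p q = ([set p; q] \in cycle_pairs u v w x).
Proof. by rewrite /toggled !inE. Qed.

Lemma uniq_cycle (u v w x : V) : uniq [:: u; v; w; x] ->
  uniq (cycle_edges u v w x ++ cycle_nonedges u v w x).
Proof.
case/uniq4P=> [[? ? ?] [? ? ?]]; rewrite /= !inE !negb_or.
by repeat (apply/andP; split); apply/eqP => // /set2_eqP[][? ?]; congruence.
Qed.

Lemma cards_cycle_pairs (u v w x : V) : uniq [:: u; v; w; x] ->
  #|cycle_pairs u v w x| = 4.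
Proof. by move/uniq_cycle => U; rewrite cardsE; move/card_uniqP: U => ->. Qed.

Lemma cards_common_pairs u v w x u' v' w' x' :
  alternating G u v w x -> alternating G u' v' w' x' ->
  #|cycle_pairs u v w x :&: cycle_pairs u' v' w' x'| = common_pairs u v w x u' v'
    w' x'.
Proof.
move=> A1 A2; have /andP[U2 _] := A2.
have -> : cycle_pairs u v w x :&: cycle_pairs u' v' w' x' =
  [set e in filter (mem (cycle_pairs u v w x)) (cycle_edges u' v' w' x' ++
    cycle_nonedges u' v' w' x')].
  by apply/setP => e; rewrite [RHS]inE mem_filter [e \in _ :&: _]inE /= [e \in
    cycle_pairs u' _ _ _]inE.
rewrite cardsE; have /card_uniqP-> := filter_uniq (mem (cycle_pairs u v w x))
  (uniq_cycle U2).
rewrite size_filter count_cat /common_pairs.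
case/and5P: A1 => _ uv wx ux vw; case/and5P: A2 => _ uv' wx' ux' vw'.
congr (_ + _); apply: eq_in_count => e eE.
  rewrite /= !inE orbA; case: ((e == [set u; v]) || _) => //=.
  have : e \in edges G by move: eE; rewrite !inE => /orP[]/eqP->.
  by apply: contraTF => /orP[]/eqP->.
rewrite /= !inE orbA orbC; case: ((e == [set u; x]) || _) => //=.
have : e \notin edges G by move: eE; rewrite !inE => /orP[]/eqP->.
by apply: contraNF => /orP[]/eqP->.
Qed.

(** Switching [G] along either cycle gives two realizations that differ on the symmetric difference
    of the cycles. With [k] common pairs it has [8 - 2k] elements, and being itself the set of pairs
    of a 2-switch it has four. *)
Lemma alternating_common u v w x u' v' w' x' :
  alternating G u v w x -> alternating G u' v' w' x' ->
  cycle_pairs u v w x <> cycle_pairs u' v' w' x' ->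
  common_pairs u v w x u' v' w' x' = 2.
Proof.
move=> A1 A2 n; rewrite -(cards_common_pairs A1 A2).
have sw : two_switch (switched G u v w x) (switched G u' v' w' x').
  apply: all_switch; try exact: deg_switched.
  apply/eqP => E; apply: n.
  apply/setP => e; suff [[p [q ->]]|[-> ->//]] :
    (exists p q, e = [set p; q]) \/
    (e \in cycle_pairs u v w x) = false /\ (e \in cycle_pairs u' v' w' x') = false.
    have := congr1 (fun H => adj H p q) E.
    by rewrite !adj_switched // !toggledE => /addbI.
  case: (boolP (e \in cycle_pairs u v w x)); first by rewrite !inE =>
    /or4P[]/eqP->; left; eauto.
  case: (boolP (e \in cycle_pairs u' v' w' x'));
    first by rewrite !inE => /or4P[]/eqP->; left; eauto.
  by right.
case/two_switchP: sw => p [q [r [s [alt eH]]]].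
have eT : cycle_pairs p q r s = (cycle_pairs u v w x :\: cycle_pairs u' v' w' x')
  :|:
   (cycle_pairs u' v' w' x' :\: cycle_pairs u v w x).
  have eT i j : ([set i; j] \in cycle_pairs p q r s) =
     ([set i; j] \in cycle_pairs u v w x) (+) ([set i;
       j] \in cycle_pairs u' v' w' x').
    by have := eH i j; rewrite !adj_switched // !toggledE; case: (adj G i j);
      do 3!case: (_ \in _).
  apply/setP => e; suff [[i [j ->]]|[e1 e2 e3]] :
    (exists i j, e = [set i; j]) \/
    [/\ (e \in cycle_pairs p q r s) = false, (e \in cycle_pairs u v w x) = false &
      (e \in cycle_pairs u' v' w' x') = false].
  - rewrite eT in_setU 2!in_setD; by case: (_ \in _); case: (_ \in _).
  - by rewrite in_setU 2!in_setD e1 e2 e3.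
  case: (boolP (e \in cycle_pairs p q r s)); first by rewrite !inE =>
    /or4P[]/eqP->; left; eauto.
  case: (boolP (e \in cycle_pairs u v w x)); first by rewrite !inE =>
    /or4P[]/eqP->; left; eauto.
  case: (boolP (e \in cycle_pairs u' v' w' x'));
    first by rewrite !inE => /or4P[]/eqP->; left; eauto.
  by right.
have := cards_cycle_pairs (proj1 (andP alt)).
have := cards_cycle_pairs (proj1 (andP A1)).
have := cards_cycle_pairs (proj1 (andP A2)).
rewrite eT cardsU.
have -> : (cycle_pairs u v w x :\: cycle_pairs u' v' w' x') :&:
   (cycle_pairs u' v' w' x' :\: cycle_pairs u v w x) = set0.
  by apply/setP => e; rewrite in_setI !in_setD in_set0; case: (_ \in _);
    rewrite ?andbF.
rewrite cards0 subn0 !cardsD [cycle_pairs u' _ _ _ :&: _]setIC => -> ->.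
have := subset_leq_card (subsetIl (cycle_pairs u v w x) (cycle_pairs u' v' w' x')).
by rewrite (cards_cycle_pairs (proj1 (andP A1))); clear; lia.
Qed.

Definition same_degrees : {set sgraph V} := [set H | [forall v, deg H v == deg G
  v]].

Lemma same_degreesP H : reflect (deg H =1 deg G) (H \in same_degrees).
Proof. by rewrite inE; apply: (iffP forallP) => h v; apply/eqP. Qed.

(** The three realizations other than [G] are reached from [G] along three different cycles, as many
    as [common_hub] asks for. *)
Lemma hub_exists : 4 <= #|same_degrees| ->
  exists a x c, (exists y, alternating G a x c y) /\
    forall p q r s, alternating G p q r s ->
    exists2 y, alternating G a x c y & cycle_pairs p q r s = cycle_pairs a x c y.
Proof.
move=> R4; have GR : G \in same_degrees by apply/same_degreesP.
have : 2 < #|same_degrees :\ G| by move: R4; rewrite (cardsD1 G) GR.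
case/card_gt2P=> H1 [H2 [H3 [[]]]]; rewrite !in_setD1.
move=> /andP[n1 /same_degreesP R1] /andP[n2 /same_degreesP R2] /andP[n3
  /same_degreesP R3].
case=> n12 n23 n31.
have sw H : H != G -> deg H =1 deg G -> exists u v w x, alternating G u v w x /\
     forall p q, adj H p q = adj G p q (+) toggled u v w x p q.
  by move=> nH RH; apply/two_switchP/all_switch => //; rewrite eq_sym.
have [u1 [v1 [w1 [x1 [A1 E1]]]]] := sw _ n1 R1.
have [u2 [v2 [w2 [x2 [A2 E2]]]]] := sw _ n2 R2.
have [u3 [v3 [w3 [x3 [A3 E3]]]]] := sw _ n3 R3.
have [|||a [x [c hub]]] := common_hub (A := alternating G) (fun u v w x h => proj1
  (andP h))
   (@alternatingC _ G) (@alternating_rot _ G) alternating_common A1 A2 A3.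
- by move=> e; case/eqP: n12; apply: sgraph_ext => p q; rewrite E1 E2 !toggledE e.
- by move=> e; case/eqP: n31; apply: sgraph_ext => p q; rewrite E1 E3 !toggledE e.
- by move=> e; case/eqP: n23; apply: sgraph_ext => p q; rewrite E2 E3 !toggledE e.
exists a, x, c; split=> //.
by have [y Ay _] := hub _ _ _ _ A1; exists y.
Qed.

End AlternatingFamily.

(* The labels 0, 1, 2, 3, 4 mark, in this order, the clique part of t, the
   clique part of alpha, t', the independent part of alpha and the independent
   part of t; only the pairs with label sum 4 are free in t o alpha o t'. *)
Definition layered (V : finType) (lab : V -> nat) (G : sgraph V) : Prop :=
  forall u v, u != v -> (lab u + lab v < 4 -> adj G u v) /\
                        (4 < lab u + lab v -> ~~ adj G u v).

(** * From homogeneity towards a clique and an independent set to layers *)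

Section Layers.
Variables (V : finType) (G : sgraph V) (K J : {set V}) (k0 k1 j0 j1 : V).
Hypothesis KJ : [disjoint K & J].
Hypotheses (Kcl : clique G K) (Jind : independent G J).
Hypotheses (k0K : k0 \in K) (k1K : k1 \in K) (k01 : k0 != k1).
Hypotheses (j0J : j0 \in J) (j1J : j1 \in J) (j01 : j0 != j1).
Hypotheses (kj : adj G k0 j0) (kj' : ~~ adj G k1 j0).
Hypothesis no_alt : forall p q r s, alternating G p q r s -> (p \in K) || (p \in J).
Hypothesis K_homog : forall z k, z \notin K -> z \notin J -> k \in K ->
  adj G z k = adj G z k0.
Hypothesis J_homog : forall z j, z \notin K -> z \notin J -> j \in J ->
  adj G z j = adj G z j0.
Hypothesis JK_homog : forall z, z \notin K -> z \notin J ->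
  adj G z j0 -> adj G z k0.

(** Homogeneity leaves three types of vertices outside [K] and [J]: joined to both sets, to [K]
    alone, or to neither. [JK_homog] excludes those joined to [J] alone. *)
Definition layer (z : V) : nat :=
  if z \in K then 1 else if z \in J then 3 else
  if adj G z j0 then 0 else if adj G z k0 then 2 else 4.

Lemma outside p q r s : p \notin K -> p \notin J ->
  p != r -> q != s -> p != s -> q != r ->
  adj G p q -> adj G r s -> adj G p s || adj G q r.
Proof.
move=> pK pJ pr qs ps qr pq rs; apply/negPn/negP; rewrite negb_or => /andP[nps nqr].
have := @no_alt p q r s; rewrite (negPf pK) (negPf pJ) => h.
by suff /h : alternating G p q r s by []; apply: alternatingI.
Qed.

Variant layer_spec z : nat -> Prop :=
  | LayerD of z \notin K & z \notin J & adj G z j0 : layer_spec z 0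
  | LayerK of z \in K : layer_spec z 1
  | LayerM of z \notin K & z \notin J & ~~ adj G z j0 & adj G z k0 : layer_spec z 2
  | LayerJ of z \in J : layer_spec z 3
  | LayerI of z \notin K & z \notin J & ~~ adj G z j0 & ~~ adj G z k0 : layer_spec
    z 4.

Lemma layerP z : layer_spec z (layer z).
Proof.
rewrite /layer; case: (boolP (z \in K)) => zK; first exact: LayerK.
case: (boolP (z \in J)) => zJ; first exact: LayerJ.
case: (boolP (adj G z j0)) => zj; first exact: LayerD.
by case: (boolP (adj G z k0)) => zk; [exact: LayerM|exact: LayerI].
Qed.

(** Pairs that meet [K] or [J] follow from homogeneity. For two outside vertices a wrong adjacency
    would close an alternating cycle with a witness pair: the nonedge [j0 j1] for labels 0, 0, the
    nonedge [j0 k1] for 0, 2, the edge [j0 k0] for 2, 4, and the edge [k0 k1] for 4, 4. *)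
Lemma layer_layered : layered layer G.
Proof.
have nK z k : z \notin K -> k \in K -> z != k by move=> zK; apply: contraTneq => <-.
have nJ z j : z \notin J -> j \in J -> z != j by move=> zJ; apply: contraTneq => <-.
have KJn k j : k \in K -> j \in J -> k != j.
  by move=> kK jJ; apply: contraTneq jJ => <-; rewrite (disjointFr KJ).
move=> u v; wlog le_uv : u v / layer u <= layer v.
  move=> H uv; have [le|/ltnW le] := leqP (layer u) (layer v); first exact: H.
  by rewrite addnC adjC; apply: H; rewrite // eq_sym.
move: le_uv; case: layerP => [uK uJ uj|uK|uK uJ uj uk|uJ|uK uJ uj uk];
  case: layerP => [vK vJ vj|vK|vK vJ vj vk|vJ|vK vJ vj vk] // _ uv; split=> // _.
- have := @outside u j0 j1 v uK uJ (nJ _ _ uJ j1J) _ uv j01 uj.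
  rewrite eq_sym nJ // adjC (J_homog vK vJ j1J) vj (negPf (Jind j0J j1J)) orbF.
  exact.
- by rewrite K_homog // JK_homog.
- have := @outside u j0 k1 v uK uJ (nK _ _ uK k1K) _ uv _ uj.
  rewrite eq_sym nJ // adjC (K_homog vK vJ k1K) vk eq_sym KJn //.
  by rewrite [adj G j0 _]adjC (negPf kj') orbF; apply.
- by rewrite J_homog.
- exact: Kcl.
- by rewrite adjC K_homog.
- by rewrite adjC K_homog.
- by rewrite J_homog.
- apply/negP => uv'; have := @outside v u j0 k0 vK vJ (nJ _ _ vJ j0J) (nK _ _ uK
  k0K) (nK _ _ vK k0K) (nJ _ _ uJ j0J).
  by rewrite [adj G v u]adjC uv' [adj G j0 _]adjC kj (negPf vk) (negPf uj) => /(_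
    isT isT).
- exact: Jind.
- by rewrite adjC J_homog.
- apply/negP => uv'; have := @outside u v k0 k1 uK uJ (nK _ _ uK k0K) (nK _ _ vK
  k1K) (nK _ _ uK k1K) (nK _ _ vK k0K).
  by rewrite uv' Kcl // (K_homog uK uJ k1K) (negPf uk) (negPf vk) => /(_ isT isT).
Qed.

End Layers.

(** * Adjacencies around the hubs and leaves *)

Section HubLayers.
Variables (V : finType) (G : sgraph V) (a x c y0 : V).
Hypothesis alt0 : alternating G a x c y0.
Hypothesis hub : forall p q r s, alternating G p q r s ->
  exists2 y, alternating G a x c y & cycle_pairs p q r s = cycle_pairs a x c y.

(** [x] is the leaf currently joined to [a]; the other leaves are those to which a switch can move
    this edge. *)
Definition leaves : {set V} := x |: [set y | alternating G a x c y].
Definition hubs : {set V} := [set a; c].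

(** This and [hub_nonedge] are the tests used below: a 4-tuple whose edges omit [ax], or whose
    nonedges omit [xc], cannot alternate. *)
Lemma hub_edge p q r s : alternating G p q r s ->
  [set a; x] = [set p; q] \/ [set a; x] = [set r; s].
Proof.
move=> alt; have [y /and5P[_ ax _ _ _] E] := hub alt.
have : [set a; x] \in cycle_pairs p q r s by rewrite E !inE eqxx.
case/and5P: alt => _ _ _ ps qr; move: ps qr ax; rewrite /adj !inE.
by move=> ps qr ax /or4P[]/eqP e; auto; rewrite -e ax in ps qr *.
Qed.

Lemma hub_nonedge p q r s : alternating G p q r s ->
  [set x; c] = [set p; s] \/ [set x; c] = [set q; r].
Proof.
move=> alt; have [y /and5P[_ _ _ _ xc] E] := hub alt.
have : [set x; c] \in cycle_pairs p q r s by rewrite E !inE eqxx !orbT.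
case/and5P: alt => _ pq rs _ _; move: pq rs xc; rewrite /adj !inE.
by move=> pq rs xc /or4P[]/eqP e; auto; rewrite e ?pq ?rs in xc.
Qed.

Lemma alternating_hub_leaf p q r s : alternating G p q r s ->
  (p \in hubs) || (p \in leaves).
Proof.
move=> alt; have [y Ay E] := hub alt.
have : [set p; q] \in cycle_pairs a x c y by rewrite -E !inE eqxx.
have yL : y \in leaves by rewrite !inE Ay orbT.
have xL : x \in leaves by rewrite !inE eqxx.
by rewrite !inE => /or4P[]/eqP/set2_eqP[][-> _]; rewrite ?eqxx ?Ay ?orbT.
Qed.

Lemma leafP y : y \in leaves -> y != x -> alternating G a x c y.
Proof. by rewrite !inE => /orP[/eqP->|//]; rewrite eqxx. Qed.

(** If [ac] and [xy] were both edges, [a c x y] would alternate without the edge [ax]; if neither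
    were, [a x y c] would alternate without the nonedge [xc]. *)
Lemma adj_leaf_x y : alternating G a x c y -> adj G x y = ~~ adj G a c.
Proof.
move=> alt; case/and5P: (alt) => /uniq4P[[/eqP ax /eqP ac /eqP ay] [/eqP xc /eqP xy
  /eqP cy]] Gax Gcy Gay Gxc.
case: (boolP (adj G a c)) => Gac; case: (boolP (adj G x y)) => Gxy //=.
  suff /hub_edge[] : alternating G a c x y by case/set2_eqP=> -[e1 e2];
    move: ax ac ay xc xy cy; rewrite -?e1 -?e2 ?e1 ?e2 ?eqxx.
  by apply: alternatingI => //; rewrite 1?adjC // eq_sym.
suff /hub_nonedge[] : alternating G a x y c by case/set2_eqP=> -[e1 e2];
    move: ax ac ay xc xy cy; rewrite -?e1 -?e2 ?e1 ?e2 ?eqxx.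
by apply: alternatingI => //; rewrite 1?adjC // eq_sym.
Qed.

Lemma adj_leaves y y' : y \in leaves -> y' \in leaves -> y != y' ->
  adj G y y' = ~~ adj G a c.
Proof.
have [->|yx] := eqVneq y x.
  by move=> _ yL; rewrite eq_sym => yx; apply: adj_leaf_x; apply: leafP.
have [->|yx'] := eqVneq y' x.
  by move=> yL _ _; rewrite adjC; apply: adj_leaf_x; apply: leafP.
move=> /leafP/(_ yx) alt /leafP/(_ yx') alt' yy'.
have Gxy := adj_leaf_x alt; have Gxy' := adj_leaf_x alt'; move: alt alt'.
case/and5P=> /uniq4P[[/eqP ax /eqP ac /eqP ay] [/eqP xc /eqP xy /eqP cy]] Gax Gcy
  Gay Gxc.
case/and5P=> /uniq4P[[_ _ /eqP ay'] [_ /eqP xy' /eqP cy']] _ Gcy' Gay' _.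
case: (boolP (adj G a c)) => Gac; case: (boolP (adj G y y')) => Gyy //=;
  rewrite Gac /= in Gxy Gxy'.
  suff /hub_nonedge[] : alternating G a x y y' by case/set2_eqP=> -[e1 e2];
    move: ax ac ay xc xy cy; rewrite -?e1 -?e2 ?e1 ?e2 ?eqxx.
  by apply: alternatingI => //; rewrite ?Gxy.
suff /hub_edge[] : alternating G c y' y x by case/set2_eqP=> -[e1 e2];
    move: ax ac ay xc xy cy; rewrite -?e1 -?e2 ?e1 ?e2 ?eqxx.
by apply: alternatingI => //; rewrite 1?adjC ?Gxy // eq_sym.
Qed.

Lemma no_alt_outside z q r s : z \notin hubs -> z \notin leaves ->
  ~~ alternating G z q r s.
Proof. by move=> zh zl; apply/negP => /alternating_hub_leaf;
  rewrite (negPf zh) (negPf zl). Qed.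

Section Outside.
Variable z : V.
Hypotheses (zh : z \notin hubs) (zl : z \notin leaves).

Lemma outside_neq : [/\ z != a, z != c & forall l, l \in leaves -> z != l].
Proof.
split=> [||l lL]; try by move: zh; rewrite !inE negb_or => /andP[].
by apply: contraNneq zl => ->.
Qed.

Lemma xL : x \in leaves. Proof. by rewrite !inE eqxx. Qed.

(** A vertex telling [x] and [l] apart would start one of the cycles [z x c l] and [z l a x]. *)
Lemma outside_leaves l : l \in leaves -> adj G z l = adj G z x.
Proof.
have [->//|lx lL] := eqVneq l x; have := leafP lL lx.
have [za zc /(_ _ _)zL] := outside_neq; have zll := zL _ lL; have zx := zL _ xL.
case/and5P=> /uniq4P[[/eqP ax /eqP ac /eqP ay] [/eqP xc /eqP xy /eqP cy]] Gax Gcy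
  Gay Gxc.
case: (boolP (adj G z x)) => Gzx; case: (boolP (adj G z l)) => Gzl //.
  case/negP: (no_alt_outside x c l zh zl); exact: alternatingI.
case/negP: (no_alt_outside l a x zh zl); apply: alternatingI => //;
  rewrite 1?adjC // eq_sym //.
Qed.

Lemma outside_hubs : adj G z a = adj G z c.
Proof.
have [za zc zL] := outside_neq; have zx := zL _ xL.
have zy : z != y0 by apply: zL; rewrite !inE alt0 orbT.
case/and5P: alt0=> /uniq4P[[/eqP ax /eqP ac /eqP ay] [/eqP xc /eqP xy /eqP cy]] Gax
  Gcy Gay Gxc.
case: (boolP (adj G z a)) => Gza; case: (boolP (adj G z c)) => Gzc //.
  case/negP: (no_alt_outside a y0 c zh zl); apply: alternatingI => //;
    rewrite 1?adjC // eq_sym //.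
(* A vertex joined to [c] and not to [a] completes the cycle [a x c z], so it would be a leaf. *)
move: zl; rewrite !inE negb_or => /andP[_ /negP[]].
by apply: alternatingI; rewrite 1?adjC // 1?adjC // eq_sym.
Qed.

(** With [outside_costar] this excludes an outside vertex joined to the independent side of the
    configuration but not to its clique side. *)
Lemma outside_star : adj G a c -> adj G z x -> adj G z a.
Proof.
have [za zc zL] := outside_neq; have zx := zL _ xL.
case/and5P: alt0=> /uniq4P[[/eqP ax /eqP ac /eqP ay] [/eqP xc /eqP xy /eqP cy]] Gax
  Gcy Gay Gxc.
move=> Gac Gzx; apply/negPn/negP => Gza.
case/negP: (no_alt_outside x c a zh zl); apply: alternatingI;
  rewrite // 1?adjC // eq_sym //.
Qed.

Lemma outside_costar : ~~ adj G a c -> adj G z a -> adj G z x.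
Proof.
have [za zc zL] := outside_neq; have zx := zL _ xL.
case/and5P: alt0=> /uniq4P[[/eqP ax /eqP ac /eqP ay] [/eqP xc /eqP xy /eqP cy]] Gax
  Gcy Gay Gxc.
rewrite outside_hubs => Gac Gzc; apply/negPn/negP => Gzx.
case/negP: (no_alt_outside c a x zh zl); apply: alternatingI;
  rewrite // 1?adjC // eq_sym //.
Qed.

End Outside.

Definition hub_clique := if adj G a c then hubs else leaves.
Definition hub_indep := if adj G a c then leaves else hubs.

Lemma hubs_not_leaves : [/\ a \notin leaves, c \notin leaves & a != c].
Proof.
have [[/eqP ax /eqP ac _] [/eqP xc _ _]] := uniq4P (proj1 (andP alt0)).
split=> //; rewrite !inE negb_or ?ax 1?eq_sym ?xc /=.
  by apply/negP; case/andP=> /uniq4P[[_ _ h] _] _; apply: h.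
by apply/negP; case/andP=> /uniq4P[_ [_ _ h]] _; apply: h.
Qed.

Lemma hub_layered : exists2 lab : V -> nat,
  layered lab G /\ (forall z, lab z < 5) &
  forall z, (lab z == 1) = (z \in hub_clique) /\ (lab z == 3) = (z \in hub_indep).
Proof.
have [[_ _ _] [_ /eqP xy _]] := uniq4P (proj1 (andP alt0)).
have [aL cL ac] := hubs_not_leaves.
have dis : [disjoint hubs & leaves].
  by rewrite disjoint_subset; apply/subsetP => u;
    rewrite [u \in [predC _]]inE /hubs in_set2 => /orP[]/eqP->.
have yL : y0 \in leaves by rewrite !inE alt0 orbT.
have [aH cH] : a \in hubs /\ c \in hubs by rewrite set21 set22.
case/and5P: (alt0) => _ Gax Gcy Gay Gxc.
rewrite /hub_clique /hub_indep; case: (boolP (adj G a c)) => Gac.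
  (* If [ac] is an edge, the hubs form the clique and [x], joined to [a] but not to [c], separates
     them. Otherwise the leaves form the clique and [a] separates [x] from [y0]. *)
  pose lay := layer G hubs leaves a x.
  exists lay; last first.
    move=> z; rewrite /lay /layer; case: (boolP (z \in hubs)) => [zh|zh].
      by rewrite (disjointFr dis zh).
    by case: (boolP (z \in leaves)) => // zl; do 2?case: ifP.
  split; last by move=> z; rewrite /lay /layer; do !case: ifP.
  apply: (@layer_layered _ G hubs leaves a c x y0) => //; rewrite ?xL //.
  - by move=> u v; rewrite !inE => /orP[]/eqP-> /orP[]/eqP->; rewrite ?eqxx // adjC.
  - move=> u v uL vL; have [->|uv] := eqVneq u v; first by rewrite adjnn.
    by rewrite adj_leaves // Gac.
  - by rewrite adjC.
  - by move=> p q r s alt; apply: alternating_hub_leaf alt.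
  - move=> z k zh zl; rewrite !inE => /orP[]/eqP-> //.
    by rewrite outside_hubs.
  - by move=> z j zh zl; apply: outside_leaves.
  - by move=> z zh zl; apply: outside_star.
pose lay := layer G leaves hubs x a.
exists lay; last first.
  move=> z; rewrite /lay /layer; case: (boolP (z \in leaves)) => [zl|zl].
    by rewrite (disjointFl dis zl).
  by case: (boolP (z \in hubs)) => // zh; do 2?case: ifP.
split; last by move=> z; rewrite /lay /layer; do !case: ifP.
apply: (@layer_layered _ G leaves hubs x y0 a c) => //; rewrite ?xL //.
- by rewrite disjoint_sym.
- by move=> u v uL vL uv; rewrite adj_leaves.
- by move=> u v; rewrite !inE => /orP[]/eqP-> /orP[]/eqP->; rewrite ?adjnn // adjC.
- by rewrite adjC.
- by rewrite adjC.
- by move=> p q r s alt; rewrite orbC; apply: alternating_hub_leaf alt.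
- by move=> z k zl zh; apply: outside_leaves.
- move=> z k zl zh; rewrite !inE => /orP[]/eqP-> //.
  by rewrite outside_hubs.
- by move=> z zl zh; apply: outside_costar.
Qed.

End HubLayers.

(** Completeness of the realization graph, freed from ordinals and from the subtype of realizations
    by fixing one realization [G] as the reference for degrees. *)
Definition switch_complete (V : finType) (G : sgraph V) : Prop :=
  forall H1 H2 : sgraph V, deg H1 =1 deg G -> deg H2 =1 deg G ->
    H1 != H2 -> two_switch H1 H2.

Lemma adj_realization_graph d (G H : realization d) :
  adj (realization_graph d) G H = two_switch (val G) (val H).
Proof.
apply/imsetP/idP => [[[G' H']]|GH]; last by exists (G, H); rewrite ?inE.
rewrite inE => sw /set2_eqP[][-> ->]; first exact: sw.
exact: two_switch_sym sw.
Qed.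

Lemma complete_realization_graphP d n (G : sgraph 'I_(size d)) : realizes G ->
  complete_graph (realization_graph d) n <->
  #|same_degrees G| = n /\ switch_complete G.
Proof.
move=> /forallP rG.
have rP (H : sgraph 'I_(size d)) : realizes H <-> deg H =1 deg G.
  split=> [/forallP rH v|e]; last by apply/forallP => v; rewrite e.
  by rewrite (eqP (rH v)) (eqP (rG v)).
have -> : #|same_degrees G| = #|{: realization d}|.
  rewrite -(card_imset predT val_inj); apply: eq_card => H.
  apply/same_degreesP/imsetP => [/rP rH|[H' _ ->]]; last exact/rP/(valP H').
  by exists (Realization rH).
split=> -[cn all]; split=> //.
  move=> H1 H2 /rP r1 /rP r2 n12.
  by have := all (Realization r1) (Realization r2); rewrite adj_realization_graph;
    apply.
move=> H1 H2 n12; rewrite adj_realization_graph; apply: all; try exact/rP/valP.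
by rewrite (inj_eq val_inj).
Qed.

(** * Realizations parametrized by one leaf *)

Section HubFamily.
Variables (V : finType) (G : sgraph V) (a c : V) (L : {set V}).
Hypotheses (aL : a \notin L) (cL : c \notin L) (ac : a != c).

Definition hub_pair (p q : V) : bool :=
  ((p == a) || (p == c)) && (q \in L) || ((q == a) || (q == c)) && (p \in L).

Definition hub_at (H : sgraph V) (x : V) : Prop :=
  [/\ x \in L, {in L, forall l, adj H a l = (l == x)}
    & {in L, forall l, adj H c l = (l != x)}].

Hypothesis rigid : forall H, deg H =1 deg G ->
  (forall p q, ~~ hub_pair p q -> adj H p q = adj G p q) /\ exists x, hub_at H x.

Lemma hub_family_eq H1 H2 x : deg H1 =1 deg G -> deg H2 =1 deg G ->
  hub_at H1 x -> hub_at H2 x -> H1 = H2.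
Proof.
move=> d1 d2 [_ a1 c1] [_ a2 c2]; have [r1 _] := rigid d1; have [r2 _] := rigid d2.
apply: sgraph_ext => p q; have [|n] := boolP (hub_pair p q);
  last by rewrite r1 // r2.
case/orP=> /andP[/orP[]/eqP-> lL]; rewrite ?[adj _ _ a]adjC ?[adj _ _ c]adjC;
 by rewrite ?a1 ?a2 ?c1 ?c2.
Qed.

Lemma hub_at_alternating H x1 x2 : hub_at H x1 -> x2 \in L -> x2 != x1 ->
  alternating H a x1 c x2.
Proof.
move=> [xL ha hc] x2L n12; apply: alternatingI => //;
  rewrite ?ha ?hc // 1?eq_sym //.
- by rewrite adjC hc // eqxx.
- by apply: contraNneq aL => <-.
- by apply: contraNneq cL => ->.
Qed.

Lemma toggled_hub x1 x2 p q : x1 \in L -> x2 \in L ->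
  toggled a x1 c x2 p q =
  hub_pair p q && [|| p == x1, p == x2, q == x1 | q == x2].
Proof.
move=> x1L x2L; rewrite /toggled /hub_pair !set2_eq.
have na l : l \in L -> (l == a) = false /\ (l == c) = false.
  by move=> lL; split; [apply: contraNF aL|apply: contraNF cL] => /eqP <-.
have an l : l \in L -> (a == l) = false /\ (c == l) = false.
  by move=> /na[]; rewrite !(eq_sym l).
have [[a1 c1] [a2 c2]] := (na _ x1L, na _ x2L).
have [[a1' c1'] [a2' c2']] := (an _ x1L, an _ x2L).
have [->|pa] := eqVneq p a.
  rewrite a1' a2' (negPf aL) (negPf ac) /= ?andbF ?orbF.
  have [->|] := eqVneq q x1; first by rewrite x1L.
  by have [->|] := eqVneq q x2; rewrite ?x2L // andbF.
have [->|pc] := eqVneq p c.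
  rewrite c1' c2' (negPf cL) /= ?andbF ?orbF.
  have [->|] := eqVneq q x1; first by rewrite x1L orbT.
  by have [->|] := eqVneq q x2; rewrite ?x2L // andbF.
have [->|qa] := eqVneq q a.
  rewrite a1' a2' (negPf ac) /= ?andbF ?andbT ?orbF.
  have [->|] := eqVneq p x1; first by rewrite x1L.
  by have [->|] := eqVneq p x2; rewrite ?x2L // andbF.
have [->|qc] := eqVneq q c; last by rewrite /= !andbF.
rewrite c1' c2' /= ?andbF ?andbT ?orbF.
have [->|] := eqVneq p x1; first by rewrite x1L !orbT.
by have [->|] := eqVneq p x2; rewrite ?x2L // andbF.
Qed.

Lemma hub_at_switched H x1 x2 : hub_at H x1 -> x2 \in L -> x2 != x1 ->
  hub_at (switched H a x1 c x2) x2.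
Proof.
move=> h x2L n12; have alt := hub_at_alternating h x2L n12.
have na l : l \in L -> (a == l) = false /\ (c == l) = false.
  by move=> lL; split; [apply: contraNF aL|apply: contraNF cL] => /eqP ->.
case: h => xL ha hc; split=> // l lL; rewrite adj_switched // toggled_hub //;
  rewrite /hub_pair ?ha ?hc // ?eqxx lL ?orbT /=;
  have [[a1 c1] [a2 c2]] := (na _ xL, na _ x2L); rewrite ?a1 ?a2 ?c1 ?c2 /=;
  by case: (eqVneq l x1) => [->|_] /=; rewrite ?(eq_sym x1) ?(negPf n12).
Qed.

Lemma hub_family_two_switch : switch_complete G.
Proof.
move=> H1 H2 d1 d2 n12; have [_ [x1 h1]] := rigid d1; have [_ [x2 h2]] := rigid d2.
have x12 : x2 != x1.
  by apply: contraNneq n12 => e; apply/eqP; rewrite e in h2;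
    apply: hub_family_eq h1 h2.
have x2L : x2 \in L by case: h2.
have sw := two_switch_switched (hub_at_alternating h1 x2L x12).
rewrite (@hub_family_eq H2 (switched H1 a x1 c x2) x2) //.
- by move=> v; rewrite (deg_switch sw).
- exact: hub_at_switched.
Qed.

Lemma hub_family_card : #|same_degrees G| = #|L|.
Proof.
have [_ [x0 h0]] := rigid (fun v => erefl (deg G v)).
have x0L : x0 \in L by case: h0.
(* The leaf [x0] of [G] needs its own case, since [a x0 c x0] is not a cycle. *)
pose F x := if x == x0 then G else switched G a x0 c x.
have hF x : x \in L -> hub_at (F x) x.
  by move=> xL; rewrite /F; case: eqVneq => [->//|n]; apply: hub_at_switched.
have dF x : x \in L -> deg (F x) =1 deg G.
  move=> xL; rewrite /F; case: eqVneq => // n.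
  by apply: deg_switched; apply: hub_at_alternating.
rewrite -(card_in_imset (f := F)); last first.
  move=> x y xL yL e; have [_ hx _] := hF _ xL; have [_ hy _] := hF _ yL.
  by have := hx x xL; rewrite e hy // eqxx => /eqP.
apply: eq_card => H; apply/same_degreesP/imsetP => [dH|[x xL ->]]; last exact: dF.
have [_ [x hx]] := rigid dH; have xL : x \in L by case: hx.
by exists x => //; apply: (@hub_family_eq _ _ x) => //; [apply: dF|apply: hF].
Qed.

End HubFamily.

(** Moves a permutation from the degrees to the vertices, so that each term of a composition can be
    attributed to a vertex. *)
Lemma perm_map_lift (U : eqType) (f : U -> nat) (d : seq nat) (s : seq U) :
  perm_eq d (map f s) -> exists2 s', perm_eq s' s & d = map f s'.
Proof.
case: s => [|u0 s0]; first by move/perm_nilP => ->; exists [::].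
set s := u0 :: s0 => /(perm_iotaP 0)[Is pI ->].
exists (map (nth u0 s) Is).
  by apply/(perm_iotaP u0); exists Is => //; rewrite size_map in pI.
rewrite -map_comp; apply/eq_in_map => i; rewrite (perm_mem pI) mem_iota size_map =>
  /andP[_ iI].
by rewrite [RHS]/comp (nth_map u0).
Qed.

(** * Induced subgraphs and threshold sequences *)

Section Induced.
Variable V : finType.
Implicit Types (G H : sgraph V) (S : {set V}).

Definition deg_in G S (v : V) : nat := \sum_(w in S) adj G v w.

Lemma deg_in_ext G H S v : {in S, forall w, adj G v w = adj H v w} ->
  deg_in G S v = deg_in H S v.
Proof. by move=> e; apply: eq_bigr => w wS; rewrite e. Qed.

Lemma deg_split G S v : deg G v = deg_in G S v + deg_in G (~: S) v.
Proof.
rewrite deg_sum (bigID (mem S)) /=; congr (_ + _).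
by apply: eq_bigl => w; rewrite in_setC.
Qed.

(** Uniqueness of the realization for the subgraph induced on [S]. [H] lives on all of [V], though
    only its restriction to [S] matters, so that it can be glued into [G]. *)
Definition threshold_on G S : Prop :=
  forall H, {in S, deg_in H S =1 deg_in G S} ->
    {in S &, forall u v, adj H u v = adj G u v}.

Definition glue G H S : sgraph V :=
  rel_graph (fun u v => if (u \in S) && (v \in S) then adj H u v else adj G u v).

Lemma adj_glue G H S u v : adj (glue G H S) u v =
  if (u \in S) && (v \in S) then adj H u v else adj G u v.
Proof.
rewrite adj_rel_graph; last by move=> p q; rewrite andbC ![adj _ p q]adjC.
by case: eqVneq => //= ->; case: ifP; rewrite adjnn.
Qed.

Lemma deg_glue G H S : {in S, deg_in H S =1 deg_in G S} ->
  deg (glue G H S) =1 deg G.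
Proof.
move=> e v; rewrite !(deg_split _ S); congr (_ + _).
  have [vS|vS] := boolP (v \in S).
    by rewrite -e //; apply: deg_in_ext => w wS; rewrite adj_glue vS wS.
  by apply: deg_in_ext => w wS; rewrite adj_glue (negPf vS).
by apply: deg_in_ext => w; rewrite inE => wS; rewrite adj_glue (negPf wS) andbF.
Qed.

End Induced.

Section Transport.
Variables (V : finType) (m : nat) (g : 'I_m -> V).
Hypothesis g_inj : injective g.
Let S : {set V} := [set g i | i : 'I_m].

Definition pull (G : sgraph V) : sgraph 'I_m := rel_graph (fun i j => adj G (g i)
  (g j)).

Definition push (H : sgraph 'I_m) : sgraph V :=
  rel_graph (fun u v => [exists i, exists j, [&& g i == u, g j == v & adj H i j]]).

Lemma adj_pull G i j : adj (pull G) i j = adj G (g i) (g j).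
Proof.
rewrite adj_rel_graph => [|p q]; last by rewrite adjC.
by case: eqVneq => //= ->; rewrite adjnn.
Qed.

Lemma adj_push H i j : adj (push H) (g i) (g j) = adj H i j.
Proof.
rewrite adj_rel_graph => [|u v]; last first.
  by apply/existsP/existsP => -[p /existsP[q /and3P[pu qv pq]]];
    exists q; apply/existsP; exists p; rewrite pu qv adjC.
rewrite (inj_eq g_inj); have [->|ij] := eqVneq i j; first by rewrite adjnn.
apply/existsP/idP => [[p /existsP[q]]|ij'].
  by rewrite !(inj_eq g_inj) => /and3P[/eqP-> /eqP->].
by exists i; apply/existsP; exists j; rewrite !eqxx.
Qed.

Lemma deg_pull G i : deg (pull G) i = deg_in G S (g i).
Proof.
rewrite deg_sum /deg_in big_imset /=; last by move=> p q _ _; apply: g_inj.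
by apply: eq_bigr => j _; rewrite adj_pull.
Qed.

Lemma pull_push H : pull (push H) = H.
Proof. by apply: sgraph_ext => i j; rewrite adj_pull adj_push. Qed.

Lemma threshold_on_pull G : threshold_on G S <->
  (forall H : sgraph 'I_m, deg H =1 deg (pull G) -> H = pull G).
Proof.
split=> [th H dH|un H dH].
  apply: sgraph_ext => i j; rewrite -adj_push adj_pull.
  apply: th; try exact: imset_f.
  by move=> v /imsetP[k _ ->]; rewrite -!deg_pull pull_push dH.
move=> u v /imsetP[i _ ->] /imsetP[j _ ->].
rewrite -!adj_pull (un (pull H)) // => k; rewrite !deg_pull dH //; exact: imset_f.
Qed.

End Transport.

(** Degree sequences are indexed by position, so an ordering [s] of the set carries the
    ordinal-labeled notion over to [threshold_on]. *)
Lemma threshold_seqP (V : finType) (G : sgraph V) (s : seq V) : uniq s ->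
  threshold_sequence [seq deg_in G [set v in s] v | v <- s] <->
  threshold_on G [set v in s].
Proof.
move=> us; set S := [set v in s]; set d := map _ _.
pose g (i : 'I_(size d)) : V := tnth (in_tuple s) (cast_ord (size_map _ _) i).
have g_inj : injective g.
  move=> i j; rewrite /g !(tnth_nth (g i)) /= => /eqP; rewrite nth_uniq //.
  - by move/eqP/val_inj.
  - by rewrite -(size_map (deg_in G S)).
  - by rewrite -(size_map (deg_in G S)).
have gS : [set g i | i : 'I_(size d)] = S.
  apply/setP => v; rewrite inE; apply/imsetP/idP => [[i _ ->]|vs].
    by rewrite /g mem_tnth.
  have iv : index v s < size d by rewrite size_map index_mem.
  by exists (Ordinal iv) => //; rewrite /g (tnth_nth v) /= nth_index.
have rG H : realizes H <-> deg H =1 deg (pull g G).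
  have e i : deg (pull g G) i = nth 0 d i.
    rewrite deg_pull // gS (nth_map (g i)); last by rewrite -(size_map (deg_in G
      S)).
    by congr deg_in; apply: (tnth_nth (g i) (in_tuple s)).
  split=> [/forallP h i|h]; first by rewrite (eqP (h i)) e.
  by apply/forallP => i; rewrite h e.
rewrite -gS (threshold_on_pull g_inj).
have rp : realizes (pull g G) by apply/rG.
split=> [[_ /eqP/fintype1P[r0 r0P]] H /rG rH|un].
  by have := r0P (Realization rH); rewrite -(r0P (Realization rp)) => -[].
split; first by exists (pull g G).
apply/eqP/fintype1P; exists (Realization rp) => r.
by apply/val_inj/un/rG/valP.
Qed.

(** * Degree sums that force adjacencies *)

Lemma sum_eq_leq (I : finType) (P : pred I) (F F' : I -> nat) :
  (forall i, P i -> F i <= F' i) -> \sum_(i | P i) F' i <= \sum_(i | P i) F i ->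
  forall i, P i -> F i = F' i.
Proof.
move=> le ge i Pi; apply/eqP; rewrite eqn_leq le //=; move: ge.
rewrite (bigD1 i) //= [X in _ <= X](bigD1 i) //= => ge.
rewrite leqNgt; apply/negP => lt.
have : \sum_(j | P j && (j != i)) F j <= \sum_(j | P j && (j != i)) F' j.
  by apply: leq_sum => j /andP[Pj _]; apply: le.
by clear -ge lt; lia.
Qed.

Section Forcing.
Variables (V : finType) (G : sgraph V).
Implicit Types (A B : {set V}).

Lemma sum_deg_inC A B : \sum_(v in A) deg_in G B v = \sum_(v in B) deg_in G A v.
Proof.
rewrite exchange_big; apply: eq_bigr => v _; apply: eq_bigr => w _.
by rewrite adjC.
Qed.

Lemma deg_in_le A v : deg_in G A v <= #|A|.
Proof. by rewrite -sum1_card; apply: leq_sum => w _; case: adj. Qed.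

Lemma deg_in_le_pred A v : v \in A -> deg_in G A v <= #|A|.-1.
Proof.
move=> vA; rewrite (cardsD1 v) vA /= /deg_in (bigD1 v) //= adjnn add0n.
rewrite -sum1_card; under [X in _ <= X]eq_bigl => w do rewrite in_setD1 andbC.
by apply: leq_sum => w _; case: adj.
Qed.

Lemma deg_in_full A v w : deg_in G A v = #|A| -> w \in A -> adj G v w.
Proof.
rewrite -sum1_card => e wA; suff : (adj G v w : nat) = 1 by case: adj.
apply: (@sum_eq_leq _ (mem A) (fun u => adj G v u : nat) (fun _ => 1)) => // [u _|].
  by case: adj.
by rewrite -e.
Qed.

Lemma deg_in_full_pred A v w : v \in A -> deg_in G A v = #|A|.-1 ->
  w \in A -> v != w -> adj G v w.
Proof.
move=> vA e wA vw; apply: (@deg_in_full (A :\ v)); last by rewrite !inE eq_sym vw.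
move: e; rewrite (cardsD1 v) vA /= /deg_in (bigD1 v) //= adjnn add0n => <-.
by apply: eq_bigl => u; rewrite in_setD1 andbC.
Qed.

Lemma deg_in_0 A v w : deg_in G A v = 0 -> w \in A -> ~~ adj G v w.
Proof. by move/eqP; rewrite sum_nat_eq0 => /forall_inP h /h; case: adj. Qed.

(* The equality case of the Erdos-Gallai type inequality
   sum_A deg <= |A|(|A|-1) + |A||M| + sum_B deg. *)
Lemma degree_sum_forces A B : [disjoint A & B] ->
  let M := ~: (A :|: B) in
  \sum_(v in A) deg G v = \sum_(v in B) deg G v + #|A| * #|A|.-1 + #|A| * #|M| ->
  [/\ clique G A, independent G B,
      {in A & M, forall u v, adj G u v} & {in B & M, forall u v, ~~ adj G u v}].
Proof.
move=> AB M; have degE v : deg G v = deg_in G A v + deg_in G B v + deg_in G M v.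
  rewrite (deg_split _ (A :|: B)); congr (_ + _).
  rewrite /deg_in -bigU //=; apply: eq_bigl => w; by rewrite inE.
under eq_bigr do rewrite degE; under [X in _ = X + _ + _]eq_bigr do rewrite degE.
(* Edges between [A] and [B] count alike on both sides and cancel. The remaining degrees of [A] are
   then at their maximum and those of [B] vanish. *)
rewrite !big_split /= (sum_deg_inC A B) => E.
have leA : \sum_(v in A) (deg_in G A v + deg_in G M v) <= \sum_(v in A) (#|A|.-1 +
  #|M|).
  by apply: leq_sum => v vA; rewrite leq_add ?deg_in_le // deg_in_le_pred.
have cA : \sum_(v in A) (#|A|.-1 + #|M|) = #|A| * #|A|.-1 + #|A| * #|M|.
  by rewrite sum_nat_const mulnDr.
rewrite big_split /= in leA.
have B0 : \sum_(v in B) (deg_in G B v + deg_in G M v) = 0.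
  by rewrite big_split /=; clear -E leA cA; lia.
have eA v : v \in A -> deg_in G A v + deg_in G M v = #|A|.-1 + #|M|.
  apply: (@sum_eq_leq _ (mem A) (fun v => deg_in G A v + deg_in G M v)
    (fun=> #|A|.-1 + #|M|)) => [u uA|]; first by rewrite leq_add ?deg_in_le //
      deg_in_le_pred.
  rewrite !big_split /=; move: B0 cA; rewrite !big_split /=; clear -E; lia.
have eB v : v \in B -> deg_in G B v = 0 /\ deg_in G M v = 0.
  move/eqP: B0; rewrite sum_nat_eq0 => /forall_inP h /h.
  by rewrite addn_eq0 => /andP[/eqP-> /eqP->].
have eA' v : v \in A -> deg_in G A v = #|A|.-1 /\ deg_in G M v = #|M|.
  move=> vA; have := eA _ vA; have := deg_in_le_pred vA; have := deg_in_le M v.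
  by clear; lia.
split.
- move=> u v uA vA uv; have [e _] := eA' _ uA; exact: deg_in_full_pred e vA uv.
- move=> u v uB vB; have [e _] := eB _ uB; exact: deg_in_0 e vB.
- move=> u v uA vM; have [_ e] := eA' _ uA; exact: deg_in_full e vM.
- move=> u v uB vM; have [_ e] := eB _ uB; exact: deg_in_0 e vM.
Qed.

End Forcing.

(** * Degrees in layered graphs *)

Section LayerDegrees.
Variables (V : finType) (lab : V -> nat).
Hypothesis lab5 : forall v, lab v < 5.
Implicit Types (G H : sgraph V).

Definition lset (i : nat) : {set V} := [set v | lab v == i].
(** The factor of the composition containing [v]: labels 0 and 4 give [t], 1 and 3 give [alpha], and
    2 gives [t']. *)
Definition part (v : V) : {set V} := [set w | (lab w == lab v) || (lab w == 4 - lab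
  v)].
(** The increase that the composition gives to a term of label [i], namely the number of forced
    neighbours in the other factors. *)
Definition offset (i : nat) : nat :=
  \sum_(j < 5 | [&& j != i :> nat, j != 4 - i :> nat & i + j < 4]) #|lset j|.

Lemma offsetE : (offset 0 = #|lset 1| + #|lset 2| + #|lset 3|) *
  (offset 1 = #|lset 0| + #|lset 2|) * (offset 2 = #|lset 0| + #|lset 1|) *
  (offset 3 = #|lset 0|) * (offset 4 = 0).
Proof.
by rewrite /offset; do ![split]; rewrite big_mkcond !big_ord_recr big_ord0 /=
  ?addn0.
Qed.

Lemma layered_deg G v : layered lab G ->
  deg G v = deg_in G (part v) v + offset (lab v).
Proof.
move=> lay; rewrite (deg_split _ (part v)); congr (_ + _).
rewrite /offset /deg_in; under [RHS]eq_bigr do rewrite -sum1_card big_mkcond /=.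
rewrite exchange_big /= big_mkcond; apply: eq_bigr => w _.
rewrite !inE big_mkcond (bigD1 (Ordinal (lab5 w))) //= big1 ?addn0; last first.
  move=> j nj; case: ifP => // _; rewrite inE; case: eqP => // e.
  by case/eqP: nj; apply: val_inj => /=.
rewrite inE eqxx; case: eqVneq => //= wv; case: eqVneq => //= wv'.
have nvw : v != w by apply: contraNneq wv => ->.
have [h1 h2] := lay _ _ nvw; case: ltnP => h; first by rewrite h1.
by rewrite (negPf (h2 _)) //; have := lab5 v; clear -wv' h; lia.
Qed.

Definition labset (l : seq nat) : {set V} := [set v | lab v \in l].

Lemma sum_labset l (F : V -> nat) : uniq l ->
  \sum_(v in labset l) F v = \sum_(i <- l) \sum_(v in lset i) F v.
Proof.
elim: l => [_|i l IH /= /andP[il ul]]; first by rewrite big_nil big1 // => v;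
  rewrite inE.
rewrite big_cons -IH // (bigID (fun v => lab v == i)) /=; congr (_ + _);
  apply: eq_bigl => v.
  by rewrite !inE; case: eqP; rewrite ?andbF.
rewrite !inE; case: (eqVneq (lab v) i) => [->|_]; rewrite ?andbF ?andbT //.
by rewrite (negPf il).
Qed.

Lemma card_labset l : uniq l -> #|labset l| = \sum_(i <- l) #|lset i|.
Proof.
move=> ul; rewrite -sum1_card sum_labset //; apply: eq_bigr => i _.
by rewrite sum1_card.
Qed.

Lemma lab_cases v : lab v \in [:: 0; 1; 2; 3; 4].
Proof. by have := lab5 v; case: (lab v) => [|[|[|[|[|k]]]]]. Qed.

(** The two sum conditions are the split identities of [t] and [alpha]. With the offsets added they
    put [degree_sum_forces] in its equality case for label 0 against 4 and for labels 0, 1 against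
    3, 4; the two conclusions together cover all label sums other than 4. *)
Lemma layered_forced G (p : V -> nat) :
  (forall v, deg G v = p v + offset (lab v)) ->
  \sum_(v in lset 0) p v = \sum_(v in lset 4) p v + #|lset 0| * #|lset 0|.-1 ->
  \sum_(v in lset 1) p v = \sum_(v in lset 3) p v + #|lset 1| * #|lset 1|.-1 ->
  layered lab G.
Proof.
move=> dG E04 E13.
have sumdeg i : \sum_(v in lset i) deg G v = \sum_(v in lset i) p v + #|lset i| *
  offset i.
  rewrite -sum_nat_const -big_split /=; apply: eq_bigr => v; rewrite inE => /eqP e.
  by rewrite dG e.
have mid1 : ~: (labset [:: 0] :|: labset [:: 4]) = labset [:: 1; 2; 3].
  apply/setP => v; have := lab_cases v; rewrite !inE.
  by case/or4P=> [/eqP->|/eqP->|/eqP->|/orP[]/eqP->].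
have mid2 : ~: (labset [:: 0; 1] :|: labset [:: 3; 4]) = labset [:: 2].
  apply/setP => v; have := lab_cases v; rewrite !inE.
  by case/or4P=> [/eqP->|/eqP->|/eqP->|/orP[]/eqP->].
have := @degree_sum_forces _ G (labset [:: 0]) (labset [:: 4]); rewrite mid1.
have := @degree_sum_forces _ G (labset [:: 0; 1]) (labset [:: 3; 4]); rewrite mid2.
case=> [||c1 i3 c1m i3m].
- rewrite disjoint_subset; apply/subsetP => v; rewrite !inE.
  by case/orP=> /eqP->.
- rewrite !sum_labset // !card_labset // !big_cons !big_nil !addn0 !sumdeg !offsetE
  E04 E13.
  move: #|lset 0| #|lset 1| #|lset 2| #|lset 3| (\sum_(v in lset 3) _) (\sum_(v in
    lset 4) _).
  (* The predecessors of the layer sizes are truncated, so empty layers are separated before the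
     arithmetic. *)
  clear; case=> [|n0] [|n1] n2 n3 s3 s4 /=; rewrite ?addn0 ?add0n ?muln0 ?mul0n /=;
    nia.
case=> [||c0 i4 c0m i4m].
- rewrite disjoint_subset; apply/subsetP => v; rewrite !inE.
  by move=> /eqP->.
- rewrite !sum_labset // !card_labset // !big_cons !big_nil !addn0 !sumdeg !offsetE
  E04 !muln0 !addn0.
  by rewrite addnA.
have lin v l : lab v \in l -> v \in labset l by rewrite inE.
move=> u v; wlog le_uv : u v / lab u <= lab v.
  move=> W uv; have [le|/ltnW le] := leqP (lab u) (lab v); first exact: W.
  by rewrite addnC adjC; apply: W; rewrite // eq_sym.
move=> uv; move: le_uv; have := lab5 u; have := lab5 v.
case eu: (lab u) => [|[|[|[|[|?]]]]] //; case ev: (lab v) => [|[|[|[|[|?]]]]] // _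
  _ _; split=> // _.
all: first [ by apply: c1 => //; apply: lin; rewrite ?eu ?ev
           | by apply: c1m; apply: lin; rewrite ?eu ?ev
           | by apply: c0m; apply: lin; rewrite ?eu ?ev
           | by apply: i3; apply: lin; rewrite ?eu ?ev
           | by rewrite adjC; apply: i3m; apply: lin; rewrite ?eu ?ev
           | by rewrite adjC; apply: i4m; apply: lin; rewrite ?eu ?ev ].
Qed.

Lemma layered_deg_in G H v : layered lab G -> layered lab H -> deg G v = deg H v ->
  deg_in G (part v) v = deg_in H (part v) v.
Proof. by move=> lG lH; rewrite !layered_deg // => /addIn. Qed.

Section Rigid.
Variables (G : sgraph V).
Hypotheses (th04 : threshold_on G (labset [:: 0;
  4])) (th2 : threshold_on G (labset [:: 2])).

(** Layering decides the pairs of label sum other than 4. A free pair not between labels 1 and 3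
    lies inside [t] or [t'], where the degrees within the factor agree and the threshold property
    applies. *)
Lemma layered_rigid H : layered lab G -> layered lab H -> deg H =1 deg G ->
  forall u v, ~~ ((lab u == 1) && (lab v == 3) || (lab u == 3) && (lab v == 1)) ->
  adj H u v = adj G u v.
Proof.
move=> lG lH dH u v nf; have [->|uv] := eqVneq u v; first by rewrite !adjnn.
have [g1 g2] := lG _ _ uv; have [h1 h2] := lH _ _ uv.
case: (ltngtP (lab u + lab v) 4) => h.
- by rewrite g1 // h1.
- by rewrite (negPf (g2 _)) // (negPf (h2 _)).
have dp w : deg_in H (part w) w = deg_in G (part w) w by apply: layered_deg_in.
have e04 : {in labset [:: 0; 4], deg_in H (labset [:: 0;
  4]) =1 deg_in G (labset [:: 0; 4])}.
  move=> w; rewrite !inE => lw; suff <- : part w = labset [:: 0; 4] by [].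
  by apply/setP => z; rewrite !inE; case/orP: lw => /eqP->; rewrite // orbC.
have e2 : {in labset [:: 2], deg_in H (labset [:: 2]) =1 deg_in G (labset [:: 2])}.
  move=> w; rewrite !inE => /eqP lw; suff <- : part w = labset [:: 2] by [].
  by apply/setP => z; rewrite !inE lw orbb.
move: h nf; have := lab5 u; have := lab5 v.
case eu: (lab u) => [|[|[|[|[|?]]]]] //; case ev: (lab v) => [|[|[|[|[|?]]]]] // _
  _ _ _.
- by apply: th04 => //; rewrite inE ?eu ?ev.
- by apply: th2 => //; rewrite inE ?eu ?ev.
- by apply: th04 => //; rewrite inE ?eu ?ev.
Qed.

End Rigid.

End LayerDegrees.

(** Lets an omitted factor be treated as a threshold one. *)
Lemma threshold_nil : threshold_sequence [::].
Proof.
pose G0 : sgraph 'I_0 := rel_graph (fun _ _ => false).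
apply/(@threshold_seqP _ G0 [::] isT) => H _ u; by rewrite inE.
Qed.

Lemma sum_deg_split (V : finType) (G : sgraph V) (K : {set V}) :
  clique G K -> independent G (~: K) ->
  \sum_(v in K) deg G v = \sum_(v in ~: K) deg G v + #|K| * #|K|.-1.
Proof.
move=> cK iK; under eq_bigr do rewrite (deg_split _ K).
under [X in _ = X + _]eq_bigr do rewrite (deg_split _ K).
rewrite !big_split /= (sum_deg_inC G K (~: K)).
have -> : \sum_(v in ~: K) deg_in G (~: K) v = 0.
  by apply: big1 => v vK; apply: big1 => w wK; rewrite (negPf (iK _ _ vK wK)).
rewrite addn0 addnC; congr (_ + _); rewrite -sum_nat_const; apply: eq_bigr => v vK.
rewrite (cardsD1 v) vK /= /deg_in (bigD1 v) //= adjnn add0n -sum1_card.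
apply: eq_big => [w|w /andP[wK wv]]; first by rewrite in_setD1 andbC.
by rewrite cK // eq_sym.
Qed.

(** This trace of the split partition concerns the terms only, hence it can be carried to any
    realization of a composition. *)
Lemma splitted_sum (p : splitted) : splitted_degree_sequence p ->
  sumn p.1 = sumn p.2 + size p.1 * (size p.1).-1.
Proof.
case=> m [G [K [cK iK -> ->]]]; rewrite size_sort size_map -cardE.
rewrite !(perm_sumn (permEl (perm_sort _ _))) !sumnE !big_map !big_enum /=.
exact: sum_deg_split.
Qed.

(** * The star or costar factor in an arbitrary realization *)

Section HubForced.
Variables (V : finType) (lab : V -> nat) (G : sgraph V) (p : V -> nat).
Variables (a c : V) (L : {set V}).
Hypotheses (lab5 : forall v, lab v < 5)
  (degG : forall v, deg G v = p v + offset lab (lab v))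
  (sum04 : \sum_(v in lset lab 0) p v = \sum_(v in lset lab 4) p v + #|lset lab 0|
    * #|lset lab 0|.-1)
  (sum13 : \sum_(v in lset lab 1) p v = \sum_(v in lset lab 3) p v + #|lset lab 1|
    * #|lset lab 1|.-1)
  (th04 : threshold_on G (labset lab [:: 0; 4]))
  (th2 : threshold_on G (labset lab [:: 2])).
Hypotheses (ac : a != c) (aL : a \notin L) (cL : c \notin L).
Hypothesis star_costar :
  [/\ lset lab 1 = [set c; a], lset lab 3 = L, p a = 2 & {in L, forall l, p l = 1}]
    \/
  [/\ lset lab 3 = [set c; a], lset lab 1 = L, p a = 1 & {in L, forall l, p l =
    #|L|}].

Lemma hub_at_exists H : \sum_(l in L) adj H a l = 1 ->
  {in L, forall l, adj H a l + adj H c l = 1} -> exists x, hub_at a c L H x.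
Proof.
move=> sa sc; have [x xL ax] : exists2 x, x \in L & adj H a x.
  apply/exists_inP; apply: contraT; rewrite negb_exists_in => /forall_inP h;
    move: sa; rewrite big1 // => l lL.
  by rewrite (negPf (h _ lL)).
have ha : {in L, forall l, adj H a l = (l == x)}.
  move=> l lL; case: eqVneq => [->//|lx]; move: sa;
    rewrite (bigD1 x) //= (bigD1 l) /= ?lL //.
  by rewrite ax; case: adj.
exists x; split=> // l lL; have := sc _ lL; rewrite ha //.
by case: (l == x); case: adj.
Qed.

(** In the star, [a] has inner degree 2, one for [c] and one for a leaf, and a leaf has inner degree
    1, for a hub. In the costar, [a] has a single leaf, and a leaf sees the [#|L| - 1] others and
    one hub. Either way [a] has one leaf and each leaf has one hub. *)
Lemma hub_layered_at H : layered lab H -> deg H =1 deg G -> exists x, hub_at a c L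
  H x.
Proof.
move=> lH dH.
have dp v : deg_in H (part lab v) v = p v.
  by have := layered_deg lab5 v lH; rewrite dH degG => /addIn.
have dp13 v : lab v \in [:: 1; 3] ->
    \sum_(w in lset lab 1) adj H v w + \sum_(w in lset lab 3) adj H v w = p v.
  move=> lv; rewrite -dp; have -> : part lab v = labset lab [:: 1; 3].
    by apply/setP => z; move: lv; rewrite !inE => /orP[]/eqP->; rewrite // orbC.
  by rewrite /deg_in sum_labset // !big_cons big_nil addn0.
have inl i v : v \in lset lab i -> lab v = i by rewrite inE => /eqP.
case: star_costar => [[e1 e3 pa pl]|[e3 e1 pa pl]]; rewrite e1 e3 in dp13.
  have la : lab a = 1 by apply: inl; rewrite e1 set22.
  have lc : lab c = 1 by apply: inl; rewrite e1 set21.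
  apply: hub_at_exists => [|l lL].
    have := dp13 a; rewrite la inE eqxx pa => /(_ isT).
    rewrite big_setU1 ?inE 1?eq_sym //= big_set1 adjnn.
    have -> : adj H a c by have [h _] := lH _ _ ac; apply: h; rewrite la lc.
    by move/eqP; rewrite addn0 add1n eqSS => /eqP.
  have ll : lab l = 3 by apply: inl; rewrite e3.
  have := dp13 l; rewrite ll inE orbT pl // => /(_ isT).
  rewrite big_setU1 ?inE 1?eq_sym //= big_set1 big1 ?addn0.
    by rewrite addnC ![adj H l _]adjC.
  move=> w wL; have [->|lw] := eqVneq l w; first by rewrite adjnn.
  by have [_ h] := lH _ _ lw; rewrite (negPf (h _)) // ll (inl 3) ?e3.
have la : lab a = 3 by apply: inl; rewrite e3 set22.
have lc : lab c = 3 by apply: inl; rewrite e3 set21.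
apply: hub_at_exists => [|l lL].
  have := dp13 a; rewrite la inE orbT pa => /(_ isT).
  rewrite addnC big_setU1 ?inE 1?eq_sym //= big_set1 adjnn.
  by have [_ h] := lH _ _ ac; rewrite (negPf (h _)) // la lc.
have ll : lab l = 1 by apply: inl; rewrite e1.
have := dp13 l; rewrite ll inE eqxx pl // => /(_ isT).
rewrite addnC big_setU1 ?inE 1?eq_sym //= big_set1 (bigD1 l) //= adjnn add0n.
have -> : \sum_(w in L | w != l) adj H l w = #|L|.-1.
  rewrite (cardsD1 l) lL /= -sum1_card; apply: eq_big => [w|w /andP[wL wl]].
    by rewrite in_setD1 andbC.
  have [|h _] := lH l w; first by rewrite eq_sym.
  by rewrite h // ll (inl 1) ?e1.
have : 0 < #|L| by apply/card_gt0P; exists l.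
by rewrite ![adj H l _]adjC; clear; lia.
Qed.

Lemma hub_forced : #|same_degrees G| = #|L| /\ switch_complete G.
Proof.
have lay H : deg H =1 deg G -> layered lab H.
  by move=> dH; apply: (layered_forced lab5 (p := p)) => // v; rewrite dH.
have rigid H : deg H =1 deg G ->
    (forall u v, ~~ hub_pair a c L u v -> adj H u v = adj G u v) /\
    exists x, hub_at a c L H x.
  move=> dH; split; last exact: hub_layered_at (lay _ dH) dH.
  move=> u v nuv; apply: (layered_rigid lab5 th04 th2) => //; try exact: lay.
  apply: contraNN nuv.
  have le i w : (lab w == i) = (w \in lset lab i) by rewrite inE.
  rewrite /hub_pair !le; case: star_costar => [[-> -> _ _]|[-> -> _ _]];
    rewrite !inE.
    by rewrite ![(_ == c) || _]orbC [(u \in L) && _]andbC.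
  by rewrite ![(_ == c) || _]orbC [(u \in L) && _]andbC orbC.
by split; [apply: hub_family_card rigid|apply: hub_family_two_switch rigid].
Qed.

End HubForced.

(** * From a composition to a complete realization graph *)

Lemma map_cat_lift (U : Type) (f : U -> nat) s a b :
  map f s = a ++ b -> exists s1 s2, [/\ s = s1 ++ s2, map f s1 = a & map f s2 = b].
Proof.
move=> e; exists (take (size a) s), (drop (size a) s).
by rewrite cat_take_drop map_take map_drop e take_size_cat // drop_size_cat.
Qed.

Lemma map_addn_lift (U : eqType) (f : U -> nat) k l t : map f l = map (addn k) t ->
  map (fun v => f v - k) l = t /\ {in l, forall v, k <= f v}.
Proof.
move=> e; split=> [|v vl].
  have -> : [seq f v - k | v <- l] = map (subn^~ k) (map f l) by rewrite -map_comp.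
  rewrite e -map_comp.
  by apply: map_id_in => m _ /=; rewrite addKn.
by have := map_f f vl; rewrite e => /mapP[m _ ->]; rewrite leq_addr.
Qed.

Lemma map_nth_enum (d : seq nat) : [seq nth 0 d i | i : 'I_(size d)] = d.
Proof.
rewrite -[RHS](mkseq_nth 0) /mkseq -val_enum_ord -map_comp.
by [].
Qed.

Section FiveLists.
Variables (V : finType) (l0 l1 l2 l3 l4 : seq V).
Hypothesis perm5 : perm_eq (l0 ++ l1 ++ l2 ++ l3 ++ l4) (enum V).

(** The default 4 stands for [l4], since the five lists partition the vertices. *)
Definition label (v : V) : nat :=
  if v \in l0 then 0 else if v \in l1 then 1 else if v \in l2 then 2 else
  if v \in l3 then 3 else 4.

Lemma label_lt v : label v < 5.
Proof. by rewrite /label; do 4?case: ifP. Qed.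

Lemma uniq5 : [/\ uniq l0, uniq l1, uniq l2, uniq l3 & uniq l4] /\ uniq (l0 ++ l4).
Proof.
have : uniq (l0 ++ l1 ++ l2 ++ l3 ++ l4) by rewrite (perm_uniq perm5) enum_uniq.
rewrite !cat_uniq !has_cat !negb_or -!andbA.
by case/and5P=> -> _ _ _ /and5P[-> -> _ _ /and5P[_ -> _ _ /and3P[-> _ ->]]].
Qed.

Lemma mem5 v :
  (v \in l0) + (v \in l1) + (v \in l2) + (v \in l3) + (v \in l4) = 1.
Proof.
have := permP perm5 (pred1 v); rewrite (count_uniq_mem _ (enum_uniq _)) mem_enum.
have [[u0 u1 u2 u3 u4] _] := uniq5.
by rewrite !count_cat !count_uniq_mem // !addnA.
Qed.

Lemma lset_label :
  [/\ lset label 0 = [set v in l0], lset label 1 = [set v in l1],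
      lset label 2 = [set v in l2], lset label 3 = [set v in l3]
    & lset label 4 = [set v in l4]].
Proof.
by split; apply/setP => v; rewrite !inE /label; have := mem5 v;
  case: (v \in l0); case: (v \in l1); case: (v \in l2); case: (v \in l3);
    case: (v \in l4).
Qed.

Lemma card_seq_set (l : seq V) : uniq l -> #|[set v in l]| = size l.
Proof. by move=> ul; rewrite cardsE; apply/card_uniqP. Qed.

Lemma sum_seq_set (l : seq V) (F : V -> nat) : uniq l ->
  \sum_(v in [set v in l]) F v = sumn (map F l).
Proof.
move=> ul; rewrite sumnE big_map (big_uniq _ ul) /=.
by apply: eq_bigl => v; rewrite inE.
Qed.

End FiveLists.

Lemma realization_graph_of_compose n d (t alpha : splitted) (t' : seq nat) :
  0 < n -> degree_sequence d ->
  t = empty_splitted \/ splitted_threshold_sequence t ->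
  alpha = alpha_star n \/ alpha = alpha_costar n ->
  t' = [::] \/ threshold_sequence t' ->
  perm_eq d (compose (scompose t alpha) t') ->
  complete_graph (realization_graph d) n.
Proof.
move=> n0 [G rG] ht ha ht' pd; apply/(complete_realization_graphP n rG).
have {ht} [tsum tth] : sumn t.1 = sumn t.2 + size t.1 * (size t.1).-1 /\
    threshold_sequence (seq_of_splitted t).
  by case: ht => [->|[/splitted_sum]] //; split=> //; exact: threshold_nil.
have {ht'} tth' : threshold_sequence t' by case: ht' => [->|//];
  exact: threshold_nil.
(* Both forms of [alpha] satisfy the split identity; in the costar the truncated [n.-1] calls for
   [0 < n]. *)
have asum : sumn alpha.1 = sumn alpha.2 + size alpha.1 * (size alpha.1).-1.
  by case: ha => -> /=; rewrite sumn_nseq ?size_nseq; clear -n0; nia.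
pose f (v : 'I_(size d)) := nth 0 d v.
have degG v : deg G v = f v by apply/eqP/(forallP rG).
(* The vertices are ordered so that their degrees read as the composition; cutting this order at the
   factor boundaries yields the five layers. *)
move: pd; rewrite perm_sym -{1}[d]map_nth_enum => /perm_map_lift[s ps /esym].
rewrite /compose /scompose /= !map_cat -!map_comp -!catA size_cat !size_map.
case/map_cat_lift=> l0 [s1 [es e0]]; case/map_cat_lift=> l1 [s2 [es1 e1]].
case/map_cat_lift=> l2 [s3 [es2 e2]]; case/map_cat_lift=> l3 [l4 [es3 e3 e4]].
subst s s1 s2 s3.
have [L0 L1 L2 L3 L4] := lset_label ps; have [[u0 u1 u2 u3 u4] u04] := uniq5 ps.
set lab := label l0 l1 l2 l3 in L0 L1 L2 L3 L4.
have lab5 v : lab v < 5 by apply: label_lt.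
have sz0 : size l0 = size t.1 by rewrite -(size_map f) e0 size_map.
have sz1 : size l1 = size alpha.1 by rewrite -(size_map f) e1 size_map.
have sz2 : size l2 = size t' by rewrite -(size_map f) e2 size_map.
have sz3 : size l3 = size alpha.2 by rewrite -(size_map f) e3 size_map.
have o0 : offset lab 0 = size t' + size (seq_of_splitted alpha).
  by rewrite offsetE L1 L2 L3 !card_seq_set // sz1 sz2 sz3 size_cat; clear; lia.
have o1 : offset lab 1 = size t' + size t.1.
  by rewrite offsetE L0 L2 !card_seq_set // sz0 sz2 addnC.
have o2 : offset lab 2 = size t.1 + size alpha.1.
  by rewrite offsetE L0 L1 !card_seq_set // sz0 sz1.
have o3 : offset lab 3 = size t.1 by rewrite offsetE L0 !card_seq_set.
(* The term of [v] in its own factor; the bounds [h0] to [h4] make the truncated subtraction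
   exact. *)
pose p v := f v - offset lab (lab v).
have inl i v (l : seq 'I_(size d)) : lset lab i = [set v in l] -> v \in l -> lab v
  = i.
  move=> e vl; suff : v \in lset lab i by rewrite inE => /eqP.
  by rewrite e inE.
have lift i (l : seq 'I_(size d)) r : lset lab i = [set v in l] ->
    map f l = map (addn (offset lab i)) r ->
    map p l = r /\ {in l, forall v, offset lab i <= f v}.
  move=> e /map_addn_lift[<- h]; split=> //; apply/eq_in_map => v vl.
  by rewrite /p (inl _ _ _ e vl).
have [p0 h0] : map p l0 = t.1 /\ {in l0, forall v, offset lab 0 <= f v}.
  by apply: lift => //; rewrite e0 o0; apply: eq_map => k /=; rewrite addnA.
have [p1 h1] : map p l1 = alpha.1 /\ {in l1, forall v, offset lab 1 <= f v}.
  by apply: lift => //; rewrite e1 o1; apply: eq_map => k /=; rewrite addnA.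
have [p2 h2] : map p l2 = t' /\ {in l2, forall v, offset lab 2 <= f v}.
  by apply: lift => //; rewrite e2 o2.
have [p3 h3] : map p l3 = alpha.2 /\ {in l3, forall v, offset lab 3 <= f v}.
  by apply: lift => //; rewrite e3 o3.
have [p4 h4] : map p l4 = t.2 /\ {in l4, forall v, offset lab 4 <= f v}.
  by apply: lift => //; rewrite e4 !offsetE map_id_in.
have degp v : deg G v = p v + offset lab (lab v).
  rewrite degG /p subnK //; have := mem_enum predT v;
    rewrite -(perm_mem ps) !mem_cat.
  case/or4P=> [vl|vl|vl|/orP[]vl];
    by [rewrite (inl _ _ _ L0 vl) h0|rewrite (inl _ _ _ L1 vl) h1|rewrite (inl _ _
      _ L2 vl) h2
       |rewrite (inl _ _ _ L3 vl) h3|rewrite (inl _ _ _ L4 vl) h4].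
have sum04 : \sum_(v in lset lab 0) p v = \sum_(v in lset lab 4) p v + #|lset lab
  0| * #|lset lab 0|.-1.
  by rewrite L0 L4 !sum_seq_set // card_seq_set // p0 p4 sz0.
have sum13 : \sum_(v in lset lab 1) p v = \sum_(v in lset lab 3) p v + #|lset lab
  1| * #|lset lab 1|.-1.
  by rewrite L1 L3 !sum_seq_set // card_seq_set // p1 p3 sz1.
have lay := layered_forced lab5 degp sum04 sum13.
have pE v : deg_in G (part lab v) v = p v.
  by have := layered_deg lab5 v lay; rewrite degp => /addIn.
have th04 : threshold_on G (labset lab [:: 0; 4]).
  have e : labset lab [:: 0; 4] = [set v in l0 ++ l4].
    apply/setP => v; rewrite !inE mem_cat.
    by move/setP/(_ v): L0; rewrite !inE => <-; move/setP/(_ v): L4;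
      rewrite !inE => <-.
  rewrite e; apply/threshold_seqP => //; rewrite -e.
  suff -> : [seq deg_in G (labset lab [:: 0; 4]) v | v <- l0 ++ l4] =
    seq_of_splitted t by [].
  rewrite /seq_of_splitted -p0 -p4 -map_cat; apply/eq_in_map => v.
  have -> : (v \in l0 ++ l4) = (v \in labset lab [:: 0; 4]) by rewrite e inE.
  rewrite inE !inE -pE => lv; congr (deg_in G _ v); apply/setP => w; rewrite !inE.
  by case/orP: lv => /eqP->; rewrite // orbC.
have th2 : threshold_on G (labset lab [:: 2]).
  have e : labset lab [:: 2] = [set v in l2].
    by apply/setP => v; move/setP/(_ v): L2; rewrite !inE => <-.
  rewrite e; apply/threshold_seqP => //; rewrite -e.
  suff -> : [seq deg_in G (labset lab [:: 2]) v | v <- l2] = t' by [].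
  rewrite -p2; apply/eq_in_map => v vl; rewrite -pE.
  congr (deg_in G _ v); apply/setP => w; rewrite !inE (inl _ _ _ L2 vl).
  by rewrite orbb.
have nseqP (l : seq 'I_(size d)) k m : map p l = nseq k m -> {in [set v in l],
  forall v, p v = m}.
  by move=> e v; rewrite inE => /(map_f p); rewrite e mem_nseq => /andP[_ /eqP].
have two (l : seq 'I_(size d)) x y : map p l = [:: x; y] -> exists c a, l = [:: c;
  a] /\ p a = y.
  by case: l => [|c [|a []]] //= [_ <-]; exists c, a.
have dis i j (l l' : seq 'I_(size d)) v : i != j -> lset lab i = [set v in l] ->
    lset lab j = [set v in l'] -> v \in l -> v \notin l'.
  move=> ij e e' vl; apply: contra ij => vl'.
  by rewrite -(inl _ _ _ e vl) -(inl _ _ _ e' vl').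
have seq2 (c a : 'I_(size d)) : [set v in [:: c; a]] = [set c; a].
  by apply/setP => v; rewrite !inE.
case: ha => ea; rewrite ea /= in p1 p3 sz1 sz3.
  rewrite size_nseq in sz3; have [c [a [el pa]]] := two _ _ _ p1.
  have <- : #|[set v in l3]| = n by rewrite card_seq_set.
  apply: (@hub_forced _ lab G p a c) => //.
  - by move: u1; rewrite el /= inE andbT eq_sym.
  - by rewrite inE; apply: (dis 1 3 l1) => //; rewrite el !inE eqxx orbT.
  - by rewrite inE; apply: (dis 1 3 l1) => //; rewrite el !inE eqxx.
  - by left; split=> //; [rewrite L1 el seq2|exact: nseqP p3].
rewrite size_nseq in sz1; have [c [a [el pa]]] := two _ _ _ p3.
have e : #|[set v in l1]| = n by rewrite card_seq_set.
rewrite -{1}e; apply: (@hub_forced _ lab G p a c) => //.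
- by move: u3; rewrite el /= inE andbT eq_sym.
- by rewrite inE; apply: (dis 3 1 l3) => //; rewrite el !inE eqxx orbT.
- by rewrite inE; apply: (dis 3 1 l3) => //; rewrite el !inE eqxx.
- by right; split=> //; [rewrite L3 el seq2|rewrite e; exact: nseqP p1].
Qed.

(** * From a complete realization graph to a composition *)

Section HubRigid.
Variables (V : finType) (G : sgraph V) (a x c y0 : V).
Hypothesis all_switch : switch_complete G.
Hypothesis alt0 : alternating G a x c y0.
Hypothesis hub : forall p q r s, alternating G p q r s ->
  exists2 y, alternating G a x c y & cycle_pairs p q r s = cycle_pairs a x c y.
Notation L := (leaves G a x c).

Lemma hub_at_self : hub_at a c L G x.
Proof.
case/and5P: alt0 => _ Gax _ _ Gxc; split=> [|l lL|l lL]; first exact: xL.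
- have [->//|lx] := eqVneq l x; apply/negbTE.
  by case/and5P: (leafP lL lx).
- have [->|lx] := eqVneq l x; first by rewrite adjC (negPf Gxc).
  by case/and5P: (leafP lL lx).
Qed.

Lemma switch_hub H : deg H =1 deg G -> H <> G -> exists2 y, y \in L /\ y != x &
  H = switched G a x c y.
Proof.
move=> dH /eqP nH; have /two_switchP[p [q [r [s [alt E]]]]] : two_switch G H.
  by apply: all_switch => //; rewrite eq_sym.
have [y Ay e] := hub alt; exists y.
  rewrite !inE Ay orbT; split=> //; rewrite eq_sym.
  by have [_ [_ /eqP-> _]] := uniq4P (proj1 (andP Ay)).
by apply: sgraph_ext => u v; rewrite E adj_switched // !toggledE e.
Qed.

(** Supplies the hypothesis [rigid] of the hub family in this direction: another realization is one
    switch away, along a cycle through [a], [x], [c], and that switch only moves the leaf of [a]. *)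
Lemma hub_rigid H : deg H =1 deg G ->
  (forall u v, ~~ hub_pair a c L u v -> adj H u v = adj G u v) /\
  exists y, hub_at a c L H y.
Proof.
have [aL cL ac] := hubs_not_leaves alt0; move=> dH.
have [->|/eqP nH] := eqVneq H G; first by split=> //; exists x; apply: hub_at_self.
have [y [yL yx] ->] := switch_hub dH nH; split=> [u v uv|].
  rewrite (adj_switched _ _ (leafP yL yx)) (toggled_hub aL cL) ?xL //.
  by rewrite (negPf uv) addbF.
by exists y; apply: hub_at_switched hub_at_self yL yx.
Qed.

Lemma hub_threshold_on (S : {set V}) : a \notin S -> threshold_on G S.
Proof.
move=> aS H dH; have dg := deg_glue dH.
have [e|/eqP n] := eqVneq (glue G H S) G.
  by move=> u v uS vS; rewrite -[in RHS]e adj_glue uS vS.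
have [y [yL yx] e] := switch_hub dg n; have := congr1 (fun H' => adj H' a x) e.
rewrite /= adj_glue (negPf aS) adj_switched; last exact: leafP.
by rewrite toggledE !inE eqxx /=; case: (adj G a x).
Qed.

(** Identifies the parameter [n] of [alpha]: the order of the complete graph is the number of
    leaves. *)
Lemma hub_card : #|same_degrees G| = #|L|.
Proof. by have [aL cL ac] := hubs_not_leaves alt0; apply: hub_family_card hub_rigid. Qed.

Lemma sum_adj_a : \sum_(l in L) adj G a l = 1.
Proof.
have [xl ha _] := hub_at_self; rewrite (bigD1 x) //= ha // eqxx big1 ?addn0 // => l.
by case/andP=> lL lx; rewrite ha // (negPf lx).
Qed.

Lemma sum_adj_c : \sum_(l in L) adj G c l = #|L|.-1.
Proof.
have [xl _ hc] := hub_at_self; rewrite (bigD1 x) //= hc // eqxx /= add0n.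
rewrite (cardsD1 x) xl /= -sum1_card; apply: eq_big => [l|l /andP[lL lx]].
  by rewrite in_setD1 andbC.
by rewrite hc // lx.
Qed.

End HubRigid.

Lemma perm_compose (V : finType) (lab p : V -> nat) (t alpha : splitted) (t' : seq
  nat) :
  (forall v, lab v < 5) ->
  perm_eq t.1 (map p (enum (lset lab 0))) ->
  perm_eq alpha.1 (map p (enum (lset lab 1))) ->
  perm_eq t' (map p (enum (lset lab 2))) ->
  perm_eq alpha.2 (map p (enum (lset lab 3))) ->
  perm_eq t.2 (map p (enum (lset lab 4))) ->
  perm_eq [seq p v + offset lab (lab v) | v : V] (compose (scompose t alpha) t').
Proof.
move=> lab5 p0 p1 p2 p3 p4.
have part5 : perm_eq (enum V) (enum (lset lab 0) ++ enum (lset lab 1) ++ enum (lset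
  lab 2)
   ++ enum (lset lab 3) ++ enum (lset lab 4)).
  apply/allP => v _; apply/eqP.
  rewrite !count_cat !count_uniq_mem ?enum_uniq // !mem_enum !inE.
  by have := lab_cases lab5 v; rewrite !inE =>
    /or4P[/eqP->|/eqP->|/eqP->|/orP[]/eqP->].
have lift i r k : perm_eq r (map p (enum (lset lab i))) -> k = offset lab i ->
   perm_eq [seq p v + offset lab (lab v) | v <- enum (lset lab i)] (map (addn k) r).
  move=> pr ->; apply: perm_trans (perm_map _ _); last by rewrite perm_sym;
    exact: pr.
  rewrite -map_comp.
  suff -> : [seq p v + offset lab (lab v) | v <- enum (lset lab i)] =
     [seq (addn (offset lab i) \o p) v | v <- enum (lset lab i)] by apply:
       perm_refl.
  apply/eq_in_map => v; rewrite mem_enum inE => /eqP -> /=; exact: addnC.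
have sz i r : perm_eq r (map p (enum (lset lab i))) -> #|lset lab i| = size r.
  by move/perm_size; rewrite size_map -cardE.
have s0 := sz _ _ p0; have s1 := sz _ _ p1; have s2 := sz _ _ p2;
  have s3 := sz _ _ p3.
apply: perm_trans (perm_map _ part5) _.
rewrite /compose /scompose /= !map_cat -!map_comp -!catA size_cat !size_map.
apply: perm_cat.
  rewrite (eq_map (g := addn (size t' + size (seq_of_splitted alpha)))).
    by apply: lift => //; rewrite offsetE s1 s2 s3 size_cat addnA [size t' +
      _]addnC.
  by move=> k /=; rewrite addnA.
apply: perm_cat.
  rewrite (eq_map (g := addn (size t' + size t.1))).
    by apply: lift => //; rewrite offsetE s0 s2 addnC.
  by move=> k /=; rewrite addnA.
apply: perm_cat; first by apply: lift => //; rewrite offsetE s0 s1.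
apply: perm_cat; first by apply: lift => //; rewrite offsetE s0.
rewrite -[X in perm_eq _ X](map_id_in (f := addn 0)) //.
by apply: lift => //; rewrite offsetE.
Qed.

(** A splitted sequence refers to a graph on ordinals, hence the pull-back along [enum_val]; sorting
    its terms leaves them known up to permutation. *)
Lemma splitted_threshold_of_set (V : finType) (G : sgraph V) (D I : {set V}) :
  [disjoint D & I] -> clique G D -> independent G I -> threshold_on G (D :|: I) ->
  exists t, [/\ splitted_threshold_sequence t,
    perm_eq t.1 (map (deg_in G (D :|: I)) (enum D))
  & perm_eq t.2 (map (deg_in G (D :|: I)) (enum I))].
Proof.
move=> DI cD iI; set S := D :|: I => th.
pose g (i : 'I_#|S|) : V := enum_val i.
have g_inj : injective g by apply: enum_val_inj.
have gS : [set g i | i : 'I_#|S|] = S.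
  apply/setP => v; apply/imsetP/idP => [[i _ ->]|vS]; first exact: enum_valP.
  by exists (enum_rank_in vS v) => //; rewrite /g enum_rankK_in.
pose G' := pull g G; pose K := [set i | g i \in D].
have gI i : (i \in ~: K) = (g i \in I).
  have := enum_valP i; rewrite -/(g i) !inE; case: (boolP (g i \in D)) => //= gD _.
  by rewrite (disjointFr DI gD).
have pm (A : {set 'I_#|S|}) (B : {set V}) : B \subset S -> (forall i, (i \in A) =
  (g i \in B)) ->
    perm_eq [seq deg G' i | i <- enum A] [seq deg_in G S v | v <- enum B].
  move=> BS AB.
  have -> : [seq deg G' i | i <- enum A] = [seq deg_in G S v | v <- map g (enum A)].
    by rewrite -map_comp; apply: eq_map => i /=; rewrite /G' deg_pull // gS.
  apply: perm_map; apply: uniq_perm; rewrite ?enum_uniq ?map_inj_uniq ?enum_uniq //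
    => v.
  rewrite mem_enum; apply/mapP/idP => [[i]|vB];
    first by rewrite mem_enum AB => + ->.
  have : v \in [set g i | i : 'I_#|S|] by rewrite gS; apply: (subsetP BS).
  by case/imsetP=> i _ e; exists i => //; rewrite mem_enum AB -e.
pose t : splitted := (sort geq [seq deg G' v | v <- enum K], sort geq [seq deg G' v
  | v <- enum (~: K)]).
have p1 : perm_eq t.1 [seq deg_in G S v | v <- enum D].
  by rewrite perm_sort; apply: pm => [|i]; rewrite ?subsetUl ?inE.
have p2 : perm_eq t.2 [seq deg_in G S v | v <- enum I].
  by rewrite perm_sort; apply: pm => [|i]; rewrite ?subsetUr ?gI.
exists t; split=> //; split.
  exists #|S|, G', K; split=> // i j.
    by rewrite !inE adj_pull => iD jD ij; apply: cD; rewrite ?(inj_eq g_inj).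
  by rewrite !gI adj_pull; apply: iI.
have : perm_eq (seq_of_splitted t) [seq deg_in G S v | v <- enum D ++ enum I].
  by rewrite map_cat; apply: perm_cat.
(* The vertices are reordered to follow the sorted terms, because [threshold_seqP] reads the
   sequence off a list of vertices. *)
case/perm_map_lift=> s ps ->.
have us : uniq s.
  rewrite (perm_uniq ps) cat_uniq !enum_uniq /= andbT; apply/hasPn => v.
  by rewrite !mem_enum => vI; rewrite (disjointFl DI vI).
have eS : [set v in s] = S.
  by apply/setP => v; rewrite inE (perm_mem ps) mem_cat !mem_enum inE.
by rewrite -eS; apply/(threshold_seqP G us); rewrite eS.
Qed.

Lemma map_const_nseq (U : eqType) (f : U -> nat) (s : seq U) k :
  {in s, forall v, f v = k} -> map f s = nseq (size s) k.
Proof.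
move=> h; rewrite -(size_map f); apply/all_pred1P/allP => m /mapP[v vs ->].
by rewrite /= h.
Qed.

(** Omitted factors need no separate case: if the corresponding layers are empty, [t] or [t'] comes
    out empty, which counts as threshold. *)
Lemma compose_of_realization_graph n d : 4 <= n -> degree_sequence d ->
  complete_graph (realization_graph d) n ->
  exists (t : splitted) (alpha : splitted) (t' : seq nat),
     [/\ splitted_threshold_sequence t,
         alpha = alpha_star n \/ alpha = alpha_costar n,
         threshold_sequence t'
       & perm_eq d (compose (scompose t alpha) t')].
Proof.
move=> n4 [G rG] /(complete_realization_graphP n rG)[cn all_sw].
have [|a [x [c [[y0 alt0] hub]]]] := hub_exists all_sw; first by rewrite cn.
have [lab [lay lab5] labKJ] := hub_layered alt0 hub.
pose L := leaves G a x c.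
have cL : #|L| = n by rewrite -cn (hub_card all_sw alt0 hub).
have [aL cL' ac] := hubs_not_leaves alt0.
have [lset1 lset3] : lset lab 1 = hub_clique G a x c /\ lset lab 3 = hub_indep G a
  x c.
  by split; apply/setP => v; rewrite inE; have [e1 e3] := labKJ v.
have a13 : (lab a == 1) || (lab a == 3).
  have [-> ->] := labKJ a; rewrite /hub_clique /hub_indep; case: ifP => _;
  by rewrite set21 ?orbT.
have aS l : 1 \notin l -> 3 \notin l -> a \notin labset lab l.
  by move=> l1 l3; rewrite inE; case/orP: a13 => /eqP->.
have th04 : threshold_on G (labset lab [:: 0; 4]) by apply: (hub_threshold_on
  all_sw hub); apply: aS.
have th2 : threshold_on G (labset lab [:: 2]) by apply: (hub_threshold_on all_sw
  hub); apply: aS.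
pose p v := deg_in G (part lab v) v.
have S04 : labset lab [:: 0; 4] = lset lab 0 :|: lset lab 4 by apply/setP => v;
  rewrite !inE.
have S2 : labset lab [:: 2] = lset lab 2 by apply/setP => v; rewrite !inE.
rewrite S04 in th04; rewrite S2 in th2.
have p04 v : v \in lset lab 0 :|: lset lab 4 -> p v = deg_in G (lset lab 0 :|: lset
  lab 4) v.
  rewrite !inE => lv; congr (deg_in G _ v); apply/setP => w; rewrite !inE.
  by case/orP: lv => /eqP->; rewrite // orbC.
have p2 v : v \in lset lab 2 -> p v = deg_in G (lset lab 2) v.
  by rewrite !inE => /eqP lv; congr (deg_in G _ v); apply/setP => w;
    rewrite !inE lv orbb.
have p13 v : v \in hub_clique G a x c \/ v \in hub_indep G a x c -> p v =
    \sum_(w in hub_clique G a x c) adj G v w + \sum_(w in hub_indep G a x c) adj G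
      v w.
  rewrite -lset1 -lset3 !inE => lv; rewrite /p;
    have -> : part lab v = labset lab [:: 1; 3].
    by apply/setP => z; move: lv; rewrite !inE => -[]/eqP->; rewrite // orbC.
  by rewrite /deg_in sum_labset // !big_cons big_nil addn0.
have [|||t [tth t1 t2]] := @splitted_threshold_of_set _ G (lset lab 0) (lset lab 4)
  _ _ _ th04.
- by rewrite disjoint_subset; apply/subsetP => v; rewrite !inE => /eqP->.
- by move=> u v; rewrite !inE => /eqP lu /eqP lv uv; have [h _] := lay _ _ uv;
  apply: h; rewrite lu lv.
- move=> u v; rewrite !inE => /eqP lu /eqP lv; have [->|uv] := eqVneq u v;
  first by rewrite adjnn.
  by have [_ h] := lay _ _ uv; apply: h; rewrite lu lv.
pose t' := [seq p v | v <- enum (lset lab 2)].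
have tth' : threshold_sequence t'.
  have -> : t' = [seq deg_in G [set v in enum (lset lab 2)] v | v <- enum (lset lab
    2)].
    by apply/eq_in_map => v; rewrite mem_enum set_enum; apply: p2.
  by apply/threshold_seqP; rewrite ?enum_uniq // set_enum.
have [alpha [ha a1 a3]] : exists alpha : splitted, [/\ alpha = alpha_star n \/
  alpha = alpha_costar n,
    perm_eq alpha.1 (map p (enum (hub_clique G a x c))) & perm_eq alpha.2 (map p
      (enum (hub_indep G a x c)))].
  have [_ Ga Gc] := hub_at_self alt0; have lv := adj_leaves hub;
    rewrite -/L in Ga Gc lv.
  have suma := sum_adj_a alt0; have sumc := sum_adj_c alt0;
    rewrite -/L cL in suma sumc.
  (* [c] comes first because it has the larger inner degree: [n] against 2 in the star, [n.-1]
     against 1 in the costar. *)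
  have ps : perm_eq (enum (hubs a c)) [:: c; a].
    apply: uniq_perm; rewrite ?enum_uniq //= ?inE ?andbT 1?eq_sym // => v.
    by rewrite mem_enum !inE orbC.
  have n1 : n.-1.+1 = n by rewrite prednK //; apply: leq_trans n4.
  have sum2 v : \sum_(w in hubs a c) adj G v w = adj G v a + adj G v c.
    by rewrite big_setU1 ?inE //= big_set1.
  have hubE l : l \in L -> adj G l a + adj G l c = 1.
    by move=> lL; rewrite adjC Ga // adjC Gc //; case: (l == x).
  move: p13; rewrite /hub_clique /hub_indep -/L;
    case: (boolP (adj G a c)) => Gac p13.
    exists (alpha_star n); split; first by left.
      rewrite perm_sym; apply: perm_trans (perm_map _ ps) _; rewrite /= !p13 ?sum2.
      - by rewrite suma sumc !adjnn [adj G c a]adjC Gac /= addn0 !add1n n1.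
      - by left; rewrite set21.
      - by left; rewrite set22.
    rewrite (map_const_nseq (k := 1)) -?cardE ?cL // => v; rewrite mem_enum => vL.
    rewrite p13 ?sum2; last by right.
    rewrite hubE // big1 // => w wL; have [->|vw] := eqVneq v w;
      first by rewrite adjnn.
    by rewrite lv // Gac.
  exists (alpha_costar n); split; first by right.
    rewrite (map_const_nseq (k := n)) -?cardE ?cL // => v; rewrite mem_enum => vL.
    rewrite p13 ?sum2; last by left.
    rewrite hubE // (bigD1 v) //= adjnn add0n.
    have -> : \sum_(w in L | w != v) adj G v w = n.-1.
      rewrite -cL (cardsD1 v) vL /= -sum1_card; apply: eq_big => [w|w /andP[wL wv]].
        by rewrite in_setD1 andbC.
      by rewrite lv // ?Gac // eq_sym.
    by rewrite addn1.
  rewrite perm_sym; apply: perm_trans (perm_map _ ps) _; rewrite /= !p13 ?sum2.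
  - by rewrite suma sumc !adjnn [adj G c a]adjC (negPf Gac) /= !addn0.
  - by right; rewrite set21.
  - by right; rewrite set22.
exists t, alpha, t'; split=> //.
suff -> : d = [seq p v + offset lab (lab v) | v : 'I_(size d)].
  apply: perm_compose => //; rewrite ?lset1 ?lset3 //.
  - suff <- : [seq deg_in G (lset lab 0 :|: lset lab 4) v | v <- enum (lset lab 0)]
    =
        [seq p v | v <- enum (lset lab 0)] by [].
    apply/eq_in_map => v; rewrite mem_enum => lv.
    by rewrite p04 // inE lv.
  - suff <- : [seq deg_in G (lset lab 0 :|: lset lab 4) v | v <- enum (lset lab 4)]
    =
        [seq p v | v <- enum (lset lab 4)] by [].
    apply/eq_in_map => v; rewrite mem_enum => lv.
    by rewrite p04 // inE lv orbT.
rewrite -{1}[d]map_nth_enum; apply: eq_map => v.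
by rewrite /p -layered_deg // (eqP (forallP rG v)).
Qed.

Theorem theorem9 (n : nat) (d : seq nat) :
  4 <= n -> degree_sequence d ->
  (complete_graph (realization_graph d) n <->
   exists (t : splitted) (alpha : splitted) (t' : seq nat),
     [/\ t = empty_splitted \/ splitted_threshold_sequence t,
         alpha = alpha_star n \/ alpha = alpha_costar n,
         t' = [::] \/ threshold_sequence t'
       & perm_eq d (compose (scompose t alpha) t')]).
Proof.
move=> n4 dd; split=> [/(compose_of_realization_graph n4 dd)|].
  by case=> t [alpha [t' [ht ha ht' pd]]]; exists t, alpha, t'; split=> //; right.
case=> t [alpha [t' [ht ha ht' pd]]].
by apply: realization_graph_of_compose ht ha ht' pd => //; apply: leq_trans n4.
Qed.
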